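(* Let $n\ge 2$ and $p$ be $0$ or a prime. The $\binom{2n}{4}$ Plücker relations $X_{ij}X_{kl}-X_{ik}X_{jl}+X_{il}X_{jk}$ for $i<j<k<l$ in $[2n]$, together with the symplectic relation $X_{1\bar1}+X_{2\bar2}+\dots+X_{n\bar n}$, form a tropical basis of the ideal $S_{2,2n}(\mathbb{K})$; that is, $\mathrm{SpDr}(2,2n)=\mathrm{TSpGr}_p(2,2n)$. In particular, $\mathrm{TSpGr}_p(2,2n)$ does not depend on $p$.
   Context: $[2n]=\{1,\dots,n,\bar1,\dots,\bar n\}$ ordered $1<\dots<n<\bar1<\dots<\bar n$. $\mathbb{T}=\mathbb{R}\cup\{\infty\}$, $\mathbb{TP}^{N-1}=(\mathbb{T}^N\setminus\{(\infty,\dots,\infty)\})/\mathbb{R}(1,\dots,1)$. $\mathbb{K}$ is an algebraically closed field of characteristic $p$ with non-Archimedean valuation $\mathrm{val}:\mathbb{K}\to\mathbb{T}$. The standard symplectic form $\omega$ on $\mathbb{K}^{2n}$ has $\omega(e_i,e_{\bar i})=1=-\omega(e_{\bar i},e_i)$ for $i\in[n]$ and all other pairings of basis vectors $0$; $S_{2,2n}(\mathbb{K})\subseteq\mathbb{K}[X_J:J\in\binom{[2n]}{2}]$ is the ideal of polynomials vanishing on Plücker vectors of all $2$-dimensional $\omega$-isotropic subspaces of $\mathbb{K}^{2n}$. For a polynomial $f=\sum_uc_uX^u$, $\mathrm{trop}(V(f))$ is the set of $w$ with $\min_u(\mathrm{val}(c_u)+u\cdot w)$ attained at least twice. $\mathrm{TSpGr}_p(2,2n)$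 is the set of $w\in\mathbb{TP}^{\binom{2n}{2}-1}$ in $\mathrm{trop}(V(f))$ for all $f\in S_{2,2n}(\mathbb{K})$. A finite set of polynomials is a tropical basis of the ideal it generates if the intersection of the tropical hypersurfaces of its members equals the tropical variety of the ideal. $\mathrm{SpDr}(2,2n)$ is the set of $\mu\in\mathbb{TP}^{\binom{2n}{2}-1}$ such that for all $i<j<k<l$ the minimum of $\mu_{ij}+\mu_{kl},\mu_{ik}+\mu_{jl},\mu_{il}+\mu_{jk}$ is attained at least twice, and the minimum of $\mu_{1\bar1},\dots,\mu_{n\bar n}$ is attained at least twice (or is $\infty$). *)

(* Defs.v *)
From Stdlib Require Import Reals.
From HB Require Import structures.
From mathcomp Require Import all_boot all_order all_algebra.
From mathcomp Require Import mpoly.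

Set Implicit Arguments.
Unset Strict Implicit.
Unset Printing Implicit Defensive.

Import GRing.Theory.
Local Open Scope ring_scope.

(* The tropical numbers  T = R ∪ {∞}, with ∞ represented by [None].   *)
Definition trop := option R.

(* tropical product = ordinary addition, ∞ absorbing *)
Definition tadd (x y : trop) : trop :=
  match x, y with Some a, Some b => Some (Rplus a b) | _, _ => None end.

Definition tle (x y : trop) : Prop :=
  match x, y with
  | _, None => True
  | None, Some _ => False
  | Some a, Some b => Rle a b
  end.

Definition tmin (x y : trop) : trop :=
  match x, y with
  | None, _ => y
  | _, None => x
  | Some a, Some b => Some (Rmin a b)
  end.

(* k ⊙ x  (tropical k-th power = k·x), with 0·∞ = 0 *)
Definition tscale (k : nat) (x : trop) : trop :=
  if k == 0%N then Some R0
  else match x with None => None | Some a => Some (Rmult (INR k) a) end.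

Definition min_twice (s : seq trop) : Prop :=
  (forall c, (c < size s)%N -> nth None s c = None)
  \/ exists a b, [/\ (a < b)%N, (b < size s)%N,
                    nth None s a = nth None s b &
                    forall c, (c < size s)%N -> tle (nth None s a) (nth None s c)].

Definition is_valuation (K : fieldType) (val : K -> trop) : Prop :=
  [/\ forall x : K, val x = None <-> x = 0,
      forall x y : K, val (x * y) = tadd (val x) (val y) &
      forall x y : K, tle (tmin (val x) (val y)) (val (x + y))].

Definition has_char (K : fieldType) (p : nat) : Prop :=
  (p = 0%N /\ [pchar K] =i pred0) \/ (prime p /\ p \in [pchar K]).

Section Trop.
Variables (K : fieldType) (val : K -> trop) (N : nat).

Definition tdot (u : 'X_{1..N}) (w : 'I_N -> trop) : trop :=
  foldr tadd (Some R0) [seq tscale (u i) (w i) | i <- enum 'I_N].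

Definition trop_term (f : {mpoly K[N]}) (w : 'I_N -> trop) (u : 'X_{1..N}) :=
  tadd (val f@_u) (tdot u w).

Definition in_trop_hyp (f : {mpoly K[N]}) (w : 'I_N -> trop) : Prop :=
  min_twice [seq trop_term f w u | u <- msupp f].
End Trop.

(* [2n] = {1..n, 1bar..nbar} is encoded as 'I_(n+n):                    *)
(*   i  |-> lshift n (i-1),   ibar |-> rshift n (i-1);                  *)
(* the natural order of 'I_(n+n) is the order 1<..<n<1bar<..<nbar.      *)
(* The coordinates of P^(binom(2n,2)-1) are indexed by pairs i<j.       *)
Definition pairs (n : nat) := {ij : 'I_(n + n) * 'I_(n + n) | (ij.1 < ij.2)%N}.

Definition nvars (n : nat) := #|{: pairs n}|.

(* the variable X_{ij} (for i<j; 0 otherwise, never used) *)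
Definition Xp (K : fieldType) (n : nat) (i j : 'I_(n + n)) : {mpoly K[nvars n]} :=
  if insub (i, j) : option (pairs n) is Some J then 'X_(enum_rank J) else 0.

Definition coord (n : nat) (w : pairs n -> trop) (i j : 'I_(n + n)) : trop :=
  if insub (i, j) : option (pairs n) is Some J then w J else None.

Definition omega (K : fieldType) (n : nat) (x y : 'rV[K]_(n + n)) : K :=
  \sum_(k < n) (x 0 (lshift n k) * y 0 (rshift n k)
               - x 0 (rshift n k) * y 0 (lshift n k)).

Definition isotropic (K : fieldType) (n : nat) (M : 'M[K]_(2, n + n)) : Prop :=
  forall a b : 'rV[K]_2, omega (a *m M) (b *m M) = 0.

Definition plucker (K : fieldType) (n : nat) (M : 'M[K]_(2, n + n)) (J : pairs n) : K :=
  \det (\matrix_(a < 2, b < 2) M a (if b == 0 then (val J).1 else (val J).2)).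

(* S_{2,2n}(K): polynomials vanishing on the Plücker vectors of all
   2-dimensional isotropic subspaces (= row spaces of rank-2 matrices) *)
Definition S22n (K : fieldType) (n : nat) (f : {mpoly K[nvars n]}) : Prop :=
  forall M : 'M[K]_(2, n + n), \rank M = 2%N -> isotropic M ->
    f.@[fun i => plucker M (enum_val i)] = 0.

(* TSpGr_p(2,2n) (on representatives in T^N) *)
Definition TSpGr (K : fieldType) (val : K -> trop) (n : nat) (w : pairs n -> trop) : Prop :=
  forall f : {mpoly K[nvars n]}, S22n f -> in_trop_hyp val f (fun i => w (enum_val i)).

(* SpDr(2,2n) (on representatives in T^N) *)
Definition SpDr (n : nat) (w : pairs n -> trop) : Prop :=
  (forall i j k l : 'I_(n + n), (i < j)%N -> (j < k)%N -> (k < l)%N ->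
     min_twice [:: tadd (coord w i j) (coord w k l);
                   tadd (coord w i k) (coord w j l);
                   tadd (coord w i l) (coord w j k)])
  /\ min_twice [seq coord w (lshift n k) (rshift n k) | k <- enum 'I_n].

Definition plucker_rel (K : fieldType) (n : nat) (i j k l : 'I_(n + n)) : {mpoly K[nvars n]} :=
  Xp K i j * Xp K k l - Xp K i k * Xp K j l + Xp K i l * Xp K j k.

Definition sympl_rel (K : fieldType) (n : nat) : {mpoly K[nvars n]} :=
  \sum_(k < n) Xp K (lshift n k) (rshift n k).

Definition quads (n : nat) : seq ('I_(n + n) * 'I_(n + n) * 'I_(n + n) * 'I_(n + n)) :=
  filter (fun q : 'I_(n + n) * 'I_(n + n) * 'I_(n + n) * 'I_(n + n) =>
            [&& (q.1.1.1 < q.1.1.2)%N, (q.1.1.2 < q.1.2)%N & (q.1.2 < q.2)%N])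
         (enum {: 'I_(n + n) * 'I_(n + n) * 'I_(n + n) * 'I_(n + n)}).

Definition relations (K : fieldType) (n : nat) : seq {mpoly K[nvars n]} :=
  rcons [seq plucker_rel K q.1.1.1 q.1.1.2 q.1.2 q.2 | q <- quads n] (sympl_rel K n).

Definition in_ideal (K : fieldType) (N : nat) (gens : seq {mpoly K[N]}) (f : {mpoly K[N]}) : Prop :=
  exists g : 'I_(size gens) -> {mpoly K[N]}, f = \sum_(r < size gens) g r * gens`_r.

(* a point of TP^{N-1} is represented by a vector in T^N not all ∞ *)
Definition not_all_inf (n : nat) (w : pairs n -> trop) : Prop :=
  exists J, w J <> None.

(* Main.v *)
(** Write [P] for the ideal of the Plücker relations and [X12] for the first
    coordinate.  On the chart [X12 != 0] the isotropic planes form the graph of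
    a polynomial map, because there the symplectic relation can be solved for
    [X_{1 1bar}]; so a polynomial vanishing on them lies in the ideal generated
    by the relations after multiplication by a power of [X12].  This power can
    be removed: modulo [P] every polynomial is a combination of standard
    monomials (no nested pairs of indices), which stay independent on matrices
    over [K[t]], even on those with [X12 = 0] if they do not involve [X12];
    hence [X12] and the symplectic relation form a regular sequence modulo [P].

    For the tropical part, a point [w] of [SpDr] is lifted to an isotropic
    plane over a valued extension of [K].  The four-point conditions turn [w]
    into an ultrametric, realized one point at a time by adjoining variables of
    prescribed weight (Gauss valuations on polynomial rings, so that the value
    group of [K] plays no role).  As the least [w_{k kbar}] occurs twice,
    rescaling two columns by elements of valuation 0 achieves isotropy.  The
    polynomials of [S_{2,2n}(K)] lie in the ideal of the relations, so they
    vanish at the lifted point, and in a vanishing sum the least valuation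
    occurs twice. *)

Require Import Defs.
From Stdlib Require Import Reals Lra.
From mathcomp Require Import all_boot all_order all_algebra.
From mathcomp Require Import mpoly.
From mathcomp Require Import zify ring.

Set Implicit Arguments.
Unset Strict Implicit.
Unset Printing Implicit Defensive.

Import GRing.Theory.
Local Open Scope ring_scope.

(** * Degree arguments in univariate polynomials *)

(** Reduction modulo [D] isolates the lowest digit, and the others follow by induction. A single
    degree can thus encode a whole exponent vector. *)
Lemma base_digits_inj (D M : nat) (c c' : nat -> nat) :
  (forall a, (c a < D)%N) -> (forall a, (c' a < D)%N) ->
  (\sum_(a < M) c a * D ^ a = \sum_(a < M) c' a * D ^ a)%N ->
  forall a, (a < M)%N -> c a = c' a.
Proof.
elim: M c c' => [//|M IH] c c' cD c'D.
have D0 : (0 < D)%N by apply: leq_ltn_trans (cD 0%N).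
have E (d : nat -> nat) :
  (\sum_(a < M.+1) d a * D ^ a = (\sum_(a < M) d a.+1 * D ^ a) * D + d 0)%N.
  rewrite big_ord_recl /= expn0 muln1 addnC big_distrl /=; congr (_ + _)%N.
  by apply: eq_bigr => a _; rewrite /bump /= add1n expnSr mulnA.
rewrite !E => eq_c.
have c0 : c 0%N = c' 0%N.
  by move/(congr1 (modn^~ D)): (eq_c); rewrite !modnMDl !modn_small.
move: eq_c; rewrite c0 => /addIn/eqP; rewrite eqn_pmul2r // => /eqP eq_c.
case=> [//|a] aM.
exact: (IH (fun a => c a.+1) (fun a => c' a.+1)).
Qed.

(** The head and the remaining sum have different sizes, so the larger one decides and leading terms
    cannot cancel. *)
Lemma size_sum_distinct (R : idomainType) (T : eqType) (s : seq T)
    (c : T -> R) (q : T -> {poly R}) :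
  s != [::] -> uniq s -> (forall u, u \in s -> c u != 0) ->
  {in s &, injective (fun u => size (q u))} ->
  exists2 u, u \in s & size (\sum_(v <- s) c v *: q v) = size (q u).
Proof.
elim: s => [//|u s IH] _ /= /andP[us Us] c0 inj_q.
rewrite big_cons.
have cu : c u != 0 by apply: c0; rewrite mem_head.
have [->|s0] := eqVneq s [::].
  by exists u; rewrite ?mem_head // big_nil addr0 size_scale.
have [||w ws Ew] := IH s0 Us.
- by move=> x xs; apply: c0; rewrite inE xs orbT.
- by move=> x y xs ys; apply: inj_q; rewrite inE ?xs ?ys orbT.
have neq : size (q u) != size (q w).
  apply/eqP => /inj_q; rewrite mem_head inE ws orbT => /(_ isT isT) uw.
  by rewrite uw ws in us.
case: (ltngtP (size (q u)) (size (q w))) neq => // lt_s _.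
- by exists w; rewrite ?inE ?ws ?orbT // addrC size_polyDl Ew // size_scale.
- by exists u; rewrite ?mem_head // size_polyDl size_scale // Ew.
Qed.

(** Monicity is carried along so that degrees of products add up. Only the variables occurring in
    [u] are constrained, because on the test matrices below the image of [X12] may vanish. *)
Lemma size_mmap1_monic (R : idomainType) (N : nat) (h : 'I_N -> {poly R})
    (e : 'I_N -> nat) (u : 'X_{1..N}) :
  (forall i, u i != 0%N -> h i \is monic /\ size (h i) = (e i).+1) ->
  size (mmap1 h u) = (\sum_i u i * e i).+1.
Proof.
move=> hu; rewrite /mmap1.
suff [_ ->] : \prod_i h i ^+ u i \is monic /\
  size (\prod_i h i ^+ u i) = (\sum_i u i * e i).+1 by [].
apply: (big_rec2 (fun p k => p \is monic /\ size p = k.+1)).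
  by rewrite rpred1 size_poly1.
move=> i k p _ [mp sp].
have [mh sh] : h i ^+ u i \is monic /\ size (h i ^+ u i) = (u i * e i).+1.
  have [->|/hu[mh sh]] := eqVneq (u i) 0%N.
    by rewrite expr0 rpred1 size_poly1.
  have mX : h i ^+ u i \is monic by rewrite rpredX.
  split=> //; rewrite -[LHS]prednK ?size_poly_gt0 ?monic_neq0 //.
  by rewrite size_exp sh /= mulnC.
split; first by rewrite rpredM.
by rewrite size_mul ?monic_neq0 // sh sp addSn addnS.
Qed.

(* The images of the monomials of [f] have pairwise distinct degrees, so they
   cannot cancel. *)
Lemma mmap_distinct_degrees_eq0 (R : idomainType) (N : nat)
    (h : 'I_N -> {poly R}) (e : 'I_N -> nat) (f : {mpoly R[N]}) :
  (forall u i, u \in msupp f -> u i != 0%N ->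
     h i \is monic /\ size (h i) = (e i).+1) ->
  {in msupp f &, injective (fun u : 'X_{1..N} => \sum_i u i * e i)%N} ->
  mmap (@polyC R) h f = 0 -> f = 0.
Proof.
move=> hm inj_e f0; apply/eqP; rewrite -msupp_eq0; apply/negP => /negP s0.
have sz u : u \in msupp f -> size (mmap1 h u) = (\sum_i u i * e i).+1.
  by move=> uf; apply: size_mmap1_monic => i; apply: hm.
have [||u us] := @size_sum_distinct _ _ (msupp f) (fun u => f@_u) (mmap1 h) s0 (msupp_uniq f).
- by move=> u; rewrite mcoeff_msupp.
- by move=> u v us vs /=; rewrite !sz // => -[]; apply: inj_e.
move: f0; rewrite /mmap; under eq_bigr do rewrite mul_polyC.
by move=> ->; rewrite sz // size_poly0.
Qed.

(** Kronecker substitution: with [D] above all exponents, sending variable [i] to ['X^(D ^ i)] keeps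
    monomials apart, and a nonzero univariate polynomial over an algebraically closed field has a
    non-root. *)
Lemma meval_eq0 (K : closedFieldType) (N : nat) (f : {mpoly K[N]}) :
  (forall z, f.@[z] = 0) -> f = 0.
Proof.
move=> fz.
pose D := (\max_(u <- msupp f) mdeg u).+1.
have Dlt u i : u \in msupp f -> (u i < D)%N.
  move=> uf; rewrite /D ltnS.
  apply: (@bigmaxn_sup_seq _ _ u) => //.
  by rewrite mdegE (bigD1 i) //= leq_addr.
apply: (@mmap_distinct_degrees_eq0 _ _ (fun i => 'X^(D ^ i)) (fun i => D ^ i)%N).
- by move=> u i _ _; rewrite monicXn size_polyXn.
- move=> u v us vs /= E; apply/mnmP => i.
  pose c (w : 'X_{1..N}) a := if insub a is Some j then w j else 0%N.
  have cE (w : 'X_{1..N}) (j : 'I_N) : c w j = w j by rewrite /c valK.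
  have cD w a : w \in msupp f -> (c w a < D)%N.
    by rewrite /c; case: insub => // j wf; apply: Dlt.
  rewrite -!cE; apply: (@base_digits_inj D N) => //.
  + by move=> a; apply: cD.
  + by move=> a; apply: cD.
  + by under eq_bigr do rewrite cE; under [RHS]eq_bigr do rewrite cE.
- apply/eqP/negPn/negP => /closed_nonrootP[t] /negP; apply; apply/rootP.
  rewrite -[RHS](fz (fun i => t ^+ (D ^ i))) mevalE /mmap horner_sum.
  apply: eq_bigr => u _; rewrite hornerM hornerC /mmap1 horner_prod; congr (_ * _).
  by apply: eq_bigr => i _; rewrite horner_exp hornerXn.
Qed.

(** * Ideals and Plücker coordinates *)

Section Ideals.
Variables (K : fieldType) (N : nat).
Implicit Types (gens : seq {mpoly K[N]}) (f g : {mpoly K[N]}).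

Lemma in_ideal_ind gens (P : {mpoly K[N]} -> Prop) :
  P 0 -> (forall f g, P f -> P g -> P (f + g)) ->
  (forall h g, g \in gens -> P (h * g)) ->
  forall f, in_ideal gens f -> P f.
Proof.
move=> P0 PD Pg f [h ->]; apply: big_ind => // r _.
by apply: Pg; apply: mem_nth.
Qed.

Lemma in_ideal0 gens : in_ideal gens 0.
Proof. by exists (fun=> 0); rewrite big1 // => r _; rewrite mul0r. Qed.

Lemma in_idealD gens f g : in_ideal gens f -> in_ideal gens g -> in_ideal gens (f + g).
Proof.
move=> [a ->] [b ->]; exists (fun r => a r + b r).
by rewrite -big_split /=; apply: eq_bigr => r _; rewrite mulrDl.
Qed.

Lemma in_idealMl gens h f : in_ideal gens f -> in_ideal gens (h * f).
Proof.
move=> [a ->]; exists (fun r => h * a r).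
by rewrite mulr_sumr; apply: eq_bigr => r _; rewrite mulrA.
Qed.

Lemma in_idealMr gens h f : in_ideal gens f -> in_ideal gens (f * h).
Proof. by rewrite mulrC; apply: in_idealMl. Qed.

Lemma in_idealN gens f : in_ideal gens f -> in_ideal gens (- f).
Proof. by rewrite -mulN1r; apply: in_idealMl. Qed.

Lemma in_idealB gens f g : in_ideal gens f -> in_ideal gens g -> in_ideal gens (f - g).
Proof. by move=> If Ig; apply: in_idealD => //; apply: in_idealN. Qed.

Lemma in_ideal_mem gens g : g \in gens -> in_ideal gens g.
Proof.
move=> gg; pose i := Ordinal (etrans (index_mem g gens) gg).
exists (fun r => (r == i)%:R); rewrite (bigD1 i) //= eqxx mul1r nth_index //.
by rewrite big1 ?addr0 // => r /negbTE ->; rewrite mul0r.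
Qed.

Lemma in_ideal_subset gens gens' f :
  {subset gens <= gens'} -> in_ideal gens f -> in_ideal gens' f.
Proof.
move=> sub; apply: in_ideal_ind; [exact: in_ideal0 | exact: in_idealD |].
by move=> h g /sub/in_ideal_mem; apply: in_idealMl.
Qed.

Lemma in_ideal_rcons gens a f :
  in_ideal (rcons gens a) f -> exists q h, in_ideal gens q /\ f = q + h * a.
Proof.
move: f; apply: in_ideal_ind.
- by exists 0, 0; rewrite mul0r addr0; split=> //; apply: in_ideal0.
- move=> f g [q [h [Iq ->]]] [q' [h' [Iq' ->]]]; exists (q + q'), (h + h').
  by split; [apply: in_idealD | rewrite mulrDl addrACA].
- move=> h g; rewrite mem_rcons inE => /predU1P[->|gg].
    by exists 0, h; rewrite add0r; split=> //; apply: in_ideal0.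
  exists (h * g), 0; rewrite mul0r addr0; split=> //.
  by apply: in_idealMl; apply: in_ideal_mem.
Qed.

Lemma mpoly_subring_ind (P : {mpoly K[N]} -> Prop) :
  (forall c, P c%:MP) -> (forall i, P 'X_i) ->
  (forall f g, P f -> P g -> P (f + g)) ->
  (forall f g, P f -> P g -> P (f * g)) -> forall f, P f.
Proof.
move=> PC PX PD PM f; rewrite (mpolyE f);
apply: big_ind => [||u _]; [by rewrite -mpolyC0 | exact: PD |].
rewrite -mul_mpolyC; apply: (PM) => //; rewrite mpolyXE_id.
apply: big_ind => [||i _]; [by rewrite -mpolyC1 | exact: (PM) |].
elim: (u i) => [|k IH]; first by rewrite expr0 -mpolyC1.
by rewrite exprS; apply: PM.
Qed.

End Ideals.

Section Coordinates.
Variable n : nat.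

Definition lo (k : 'I_(nvars n)) : 'I_(n + n) := (val (enum_val k)).1.
Definition hi (k : 'I_(nvars n)) : 'I_(n + n) := (val (enum_val k)).2.

Lemma lo_lt_hi k : (lo k < hi k)%N.
Proof. exact: (valP (enum_val k)). Qed.

Lemma lo_hi_inj k k' : lo k = lo k' -> hi k = hi k' -> k = k'.
Proof.
move=> El Eh; apply: enum_val_inj; apply: val_inj.
by rewrite [LHS]surjective_pairing [RHS]surjective_pairing; congr (_, _).
Qed.

Lemma pair_index (i j : 'I_(n + n)) :
  (i < j)%N -> exists2 k, lo k = i & hi k = j.
Proof.
move=> ij; exists (enum_rank (Sub (i, j) ij : pairs n));
  by rewrite /lo /hi enum_rankK SubK.
Qed.

Lemma insub_lo_hi k : insub (lo k, hi k) = Some (enum_val k) :> option (pairs n).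
Proof. by rewrite /lo /hi -surjective_pairing valK. Qed.

Lemma Xp_lo_hi (K : fieldType) k : Xp K (lo k) (hi k) = 'X_k.
Proof. by rewrite /Xp insub_lo_hi enum_valK. Qed.

Lemma coord_lo_hi (w : pairs n -> trop) k : Defs.coord w (lo k) (hi k) = w (enum_val k).
Proof. by rewrite /Defs.coord insub_lo_hi. Qed.

(** The base ring varies: minors are formed over [K], over [{poly K}] for the test matrices and over
    valued extensions for the lifts. *)
Definition minors (A : comNzRingType) (x y : 'I_(n + n) -> A) (k : 'I_(nvars n)) : A :=
  x (lo k) * y (hi k) - x (hi k) * y (lo k).

(** The symplectic form of the rows [x] and [y]. *)
Definition sympl_minor (A : comNzRingType) (x y : 'I_(n + n) -> A) : A :=
  \sum_(k < n) (x (lshift n k) * y (rshift n k) - x (rshift n k) * y (lshift n k)).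

Definition pluckers (K : fieldType) : seq {mpoly K[nvars n]} :=
  [seq plucker_rel K q.1.1.1 q.1.1.2 q.1.2 q.2 | q <- quads n].

Lemma plucker_rel_in (K : fieldType) (i j k l : 'I_(n + n)) :
  (i < j)%N -> (j < k)%N -> (k < l)%N -> plucker_rel K i j k l \in pluckers K.
Proof.
move=> ij jk kl; apply/mapP; exists (i, j, k, l) => //.
by rewrite mem_filter /= ij jk kl mem_enum.
Qed.

Lemma pluckersP (K : fieldType) g :
  g \in pluckers K -> exists i j k l : 'I_(n + n),
    [/\ (i < j)%N, (j < k)%N, (k < l)%N & g = plucker_rel K i j k l].
Proof.
case/mapP=> -[[[i j] k] l] /=; rewrite mem_filter /= => /andP[/and3P[ij jk kl] _] ->.
by exists i, j, k, l.
Qed.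

Section Evaluation.
Variables (K : fieldType) (A : comNzRingType) (io : {rmorphism K -> A}).
Variables x y : 'I_(n + n) -> A.

Lemma mmap_Xp (i j : 'I_(n + n)) : (i < j)%N ->
  mmap io (minors x y) (Xp K i j) = x i * y j - x j * y i.
Proof. by case/pair_index => k <- <-; rewrite Xp_lo_hi mmapX mmap1U. Qed.

Lemma mmap_pluckers f : in_ideal (pluckers K) f -> mmap io (minors x y) f = 0.
Proof.
move: f; apply: in_ideal_ind => [|f g f0 g0|h g /pluckersP].
- by rewrite mmap0.
- by rewrite mmapD f0 g0 addr0.
case=> i [j [k [l [ij jk kl ->]]]]; rewrite rmorphM /=.
suff -> : mmap io (minors x y) (plucker_rel K i j k l) = 0 by rewrite mulr0.
rewrite /plucker_rel mmapD mmapB !rmorphM /= !mmap_Xp //; first ring.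
all: lia.
Qed.

Lemma mmap_sympl : mmap io (minors x y) (sympl_rel K n) = sympl_minor x y.
Proof.
rewrite /sympl_rel rmorph_sum /=; apply: eq_bigr => k _.
by rewrite mmap_Xp //=; have := ltn_ord k; lia.
Qed.

Lemma mmap_relations f : in_ideal (relations K n) f ->
  sympl_minor x y = 0 -> mmap io (minors x y) f = 0.
Proof.
case/in_ideal_rcons => q [h [Iq ->]] xy0.
by rewrite mmapD mmap_pluckers // rmorphM /= mmap_sympl xy0 mulr0 addr0.
Qed.

End Evaluation.
End Coordinates.

(** * Standard monomials *)

Section StandardMonomials.
Variable n : nat.
Implicit Types u v : 'X_{1..nvars n}.

(** Two-row semistandardness: the pairs [(lo k, hi k)] of the variables occurring in [u] form a
    chain in the product order. *)
Definition standard u : bool :=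
  [forall k, forall k', (u k != 0%N) ==> (u k' != 0%N) ==>
     ~~ ((lo k < lo k') && (hi k' < hi k))%N].

Definition std_poly (K : fieldType) (f : {mpoly K[nvars n]}) : Prop :=
  forall u, ~~ standard u -> f@_u = 0.

Definition span_weight u : nat := (\sum_k u k * (hi k - lo k) ^ 2)%N.

Lemma span_weightD u v : span_weight (u + v)%MM = (span_weight u + span_weight v)%N.
Proof. by rewrite /span_weight -big_split /=; apply: eq_bigr => k _; rewrite mnmDE mulnDl. Qed.

Lemma span_weightU k : span_weight U_(k)%MM = ((hi k - lo k) ^ 2)%N.
Proof.
rewrite /span_weight (bigD1 k) //= mnm1E eqxx mul1n big1 ?addn0 // => i ik.
by rewrite mnm1E eq_sym (negbTE ik).
Qed.

(* Replacing a nested pair of intervals by a crossing or a disjoint pair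
   decreases the sum of the squared lengths. *)
Lemma straighten_monomial (K : fieldType) u :
  exists2 g, std_poly g & in_ideal (pluckers n K) ('X_[u] - g).
Proof.
have [s] := ubnP (span_weight u); elim: s u => [//|s IH] u; rewrite ltnS => us.
have [su|] := boolP (standard u).
  exists 'X_[u]; last by rewrite subrr; apply: in_ideal0.
  by move=> v nv; rewrite mcoeffX; case: eqP => // E; rewrite -E su in nv.
case/forallPn=> k /forallPn[k']; rewrite !negb_imply => /and4P[uk uk' /andP[kk' k'k] _].
have neq : k != k' by apply: contraTneq kk' => ->; rewrite ltnn.
pose u' := (u - U_(k) - U_(k'))%MM.
have Eu : u = (U_(k) + U_(k') + u')%MM.
  apply/mnmP => i; rewrite !mnmDE !mnmBE !mnm1E.
  have [<-|ki] := eqVneq k i; first by rewrite eq_sym (negbTE neq); lia.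
  by have [<-|ki'] := eqVneq k' i; lia.
have k'lh := lo_lt_hi k'.
have [a la ha] := pair_index kk'.
have [b lb hb] := pair_index k'k.
have [c lc hc] := pair_index (ltn_trans kk' k'lh).
have [d ld hd] := pair_index (ltn_trans k'lh k'k).
have IHs (p q : 'I_(nvars n)) :
    ((hi p - lo p) ^ 2 + (hi q - lo q) ^ 2 <
     (hi k - lo k) ^ 2 + (hi k' - lo k') ^ 2)%N ->
    exists2 g, std_poly g &
      in_ideal (pluckers n K) ('X_p * 'X_q * 'X_[u'] - g).
  move=> lt_pq; rewrite -!mpolyXD; apply: IH.
  move: us; rewrite Eu !span_weightD !span_weightU; lia.
have [|g sg Ig] := IHs c d.
  rewrite lc hc ld hd; move: kk' k'lh k'k; clear.
  move: (nat_of_ord (lo k)) (nat_of_ord (lo k')) (nat_of_ord (hi k)) (nat_of_ord (hi k')).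
  by move=> i j l m *; nia.
have [|g' sg' Ig'] := IHs a b.
  rewrite la ha lb hb; move: kk' k'lh k'k; clear.
  move: (nat_of_ord (lo k)) (nat_of_ord (lo k')) (nat_of_ord (hi k)) (nat_of_ord (hi k')).
  by move=> i j l m *; nia.
exists (g - g'); first by move=> v nv; rewrite mcoeffB sg ?sg' ?subrr.
(* The relation on [lo k < lo k' < hi k' < hi k] writes the nested product as the crossing one ([c],
   [d]) minus the disjoint one ([a], [b]). *)
have Ip := in_ideal_mem (plucker_rel_in K kk' k'lh k'k).
have := in_idealD (in_idealMr 'X_[u'] Ip) (in_idealB Ig Ig').
rewrite Eu !mpolyXD /plucker_rel.
have -> : Xp K (lo k) (lo k') = 'X_a by rewrite -la -ha Xp_lo_hi.
have -> : Xp K (hi k') (hi k) = 'X_b by rewrite -lb -hb Xp_lo_hi.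
have -> : Xp K (lo k) (hi k') = 'X_c by rewrite -lc -hc Xp_lo_hi.
have -> : Xp K (lo k') (hi k) = 'X_d by rewrite -ld -hd Xp_lo_hi.
rewrite !Xp_lo_hi; congr in_ideal; ring.
Qed.

Lemma straighten (K : fieldType) (f : {mpoly K[nvars n]}) :
  exists2 g, std_poly g & in_ideal (pluckers n K) (f - g).
Proof.
rewrite (mpolyE f).
apply: (big_ind (fun f => exists2 g, std_poly g & in_ideal (pluckers n K) (f - g))).
- by exists 0; [move=> u _; rewrite mcoeff0 | rewrite subrr; apply: in_ideal0].
- move=> p q [g sg Ig] [g' sg' Ig']; exists (g + g').
    by move=> u nu; rewrite mcoeffD sg ?sg' ?addr0.
  by rewrite opprD addrACA; apply: in_idealD.
- move=> u _; have [g sg Ig] := straighten_monomial K u; exists (f@_u *: g).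
    by move=> v nv; rewrite mcoeffZ sg ?mulr0.
  by rewrite -scalerBr -mul_mpolyC; apply: in_idealMl.
Qed.

(** The exponents in the product of the diagonal terms [x (lo k) * y (hi k)]: positions below [2n]
    count left ends, later ones right ends. *)
Definition margin u (a : nat) : nat :=
  (\sum_k u k * ((lo k == a :> nat) + (n + n + hi k == a :> nat)))%N.

(** Double counting. It serves twice: with powers of [D] for degrees, and with indicator functions
    for one-sided counts. *)
Lemma sum_margin (G : nat -> nat) u :
  (\sum_k u k * (G (lo k) + G (n + n + hi k)) =
   \sum_(a < (n + n) + (n + n)) margin u a * G a)%N.
Proof.
have E (t : nat) : (t < (n + n) + (n + n))%N ->
    (\sum_(a < (n + n) + (n + n)) (t == a :> nat) * G a = G t)%N.
  move=> tn; rewrite (bigD1 (Ordinal tn)) //= eqxx mul1n big1 ?addn0 // => a.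
  by rewrite -val_eqE /= eq_sym => /negbTE ->.
under [RHS]eq_bigr do rewrite /margin big_distrl /=.
rewrite exchange_big /=; apply: eq_bigr => k _.
under eq_bigr do rewrite -mulnA mulnDl.
by rewrite -big_distrr /= big_split /= !E //; have := ltn_ord (lo k); have := ltn_ord (hi k); lia.
Qed.

Lemma margin_le u a : (margin u a <= 2 * mdeg u)%N.
Proof.
rewrite mdegE big_distrr /=; apply: leq_sum => k _; rewrite mulnC leq_mul2r.
by apply/orP; right; case: eqP; case: eqP.
Qed.

Definition corner u (a b : nat) : nat := (\sum_k u k * ((lo k < a) && (hi k < b)))%N.

(* The support of a standard monomial is a chain, in which [lo < a] and
   [hi < b] cut out two initial segments. *)
Lemma corner_standard u a b : standard u ->
  corner u a b = minn (\sum_k u k * (lo k < a)) (\sum_k u k * (hi k < b)).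
Proof.
move=> su.
have le1 : (corner u a b <= \sum_k u k * (lo k < a))%N.
  by apply: leq_sum => k _; rewrite leq_mul2l; case: (_ < a)%N; case: (_ < b)%N; rewrite ?orbT.
have le2 : (corner u a b <= \sum_k u k * (hi k < b))%N.
  by apply: leq_sum => k _; rewrite leq_mul2l; case: (_ < a)%N; case: (_ < b)%N; rewrite ?orbT.
have [/existsP[k0 /and3P[uk0 k0a k0b]]|/existsPn none] :=
  boolP [exists k, [&& u k != 0%N, (lo k < a)%N & (b <= hi k)%N]].
  have E : corner u a b = (\sum_k u k * (hi k < b))%N.
    apply: eq_bigr => k _; have [->|uk] := eqVneq (u k) 0%N; first by rewrite !mul0n.
    have [hb|] := ltnP (hi k) b; last by rewrite andbF.
    have [//|ka] := ltnP (lo k) a.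
    move/forallP/(_ k0)/forallP/(_ k): su; rewrite uk0 uk /=; lia.
  lia.
have E : corner u a b = (\sum_k u k * (lo k < a))%N.
  apply: eq_bigr => k _; have [->|uk] := eqVneq (u k) 0%N; first by rewrite !mul0n.
  have [la|//] := ltnP (lo k) a; have [//|hb] := ltnP (hi k) b.
  by have := none k; rewrite uk la hb.
lia.
Qed.

(** The mixed second difference of [corner] at [(lo k, hi k)] counts the single pair [k], so it
    recovers [u k]. *)
Lemma corner_inj u v : (forall a b, corner u a b = corner v a b) -> u = v.
Proof.
move=> E; apply/mnmP => k.
have D (w : 'X_{1..nvars n}) : (w k + corner w (lo k) (hi k).+1 + corner w (lo k).+1 (hi k) =
            corner w (lo k).+1 (hi k).+1 + corner w (lo k) (hi k))%N.
  have -> : w k = (\sum_i w i * (i == k))%N.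
    rewrite (bigD1 k) //= eqxx muln1 big1 ?addn0 // => i /negbTE ->.
    by rewrite muln0.
  rewrite /corner -!big_split /=; apply: eq_bigr => i _; rewrite -!mulnDr; congr (_ * _)%N.
  have -> : (i == k) = (lo i == lo k :> nat) && (hi i == hi k :> nat).
    by apply/eqP/andP => [-> //|[/eqP/val_inj ? /eqP/val_inj ?]]; apply: lo_hi_inj.
  by rewrite !ltnS; case: ltngtP; case: ltngtP.
by have := D u; have := D v; rewrite !E; lia.
Qed.

(** By [corner_standard] the joint counts of a standard monomial are minima of one-sided counts, and
    these are sums of margins. *)
Lemma standard_margin_inj u v : standard u -> standard v ->
  (forall a, (a < (n + n) + (n + n))%N -> margin u a = margin v a) -> u = v.
Proof.
move=> su sv E; apply: corner_inj => a b; rewrite !corner_standard //.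
have EG (G : nat -> nat) : (\sum_k u k * (G (lo k) + G (n + n + hi k)) =
             \sum_k v k * (G (lo k) + G (n + n + hi k)))%N.
  by rewrite !sum_margin; apply: eq_bigr => c _; rewrite E.
congr minn.
(* Cut off at [2n], the test function sees left ends only; the next one, supported from [2n] on,
   sees right ends only. *)
- have := EG (fun c => (c < a) && (c < n + n))%N.
  have F (w : 'X_{1..nvars n}) :
    (\sum_k w k * ((lo k < a) && (lo k < n + n) +
      ((n + n + hi k < a) && (n + n + hi k < n + n))) =
    \sum_k w k * (lo k < a))%N.
    by apply: eq_bigr => k _; congr (_ * _)%N; have := ltn_ord (lo k); lia.
  by rewrite !F.
- have := EG (fun c => (n + n <= c < n + n + b))%N.
  have F (w : 'X_{1..nvars n}) :
    (\sum_k w k * ((n + n <= lo k < n + n + b) +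
      (n + n <= n + n + hi k < n + n + b)) =
    \sum_k w k * (hi k < b))%N.
    by apply: eq_bigr => k _; congr (_ * _)%N; have := ltn_ord (lo k); lia.
  by rewrite !F.
Qed.

Section Independence.
Variables (K : fieldType) (b : bool) (D : nat).

(* The rows of a test matrix over [K[t]] on which the minor [ij] has degree
   [D ^ i + D ^ (2n + j)]; with [b] set, the minor [12] vanishes. *)
Definition xD (i : 'I_(n + n)) : {poly K} := 'X^(D ^ i).
Definition yD (i : 'I_(n + n)) : {poly K} :=
  if b && (i < 2)%N then 0 else 'X^(D ^ (n + n + i)).

(** The diagonal product dominates: the antidiagonal one is zero or has the smaller degree
    [D ^ hi k + D ^ (n + n + lo k)]. *)
Lemma minors_monic k : (1 < D)%N -> ~~ (b && (hi k < 2)%N) ->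
  minors xD yD k \is monic /\
  size (minors xD yD k) = (D ^ lo k + D ^ (n + n + hi k)).+1.
Proof.
move=> D1 nb; rewrite /minors /yD (negbTE nb) /xD -exprD.
set q := - _.
have sq : (size q < size ('X^(D ^ lo k + D ^ (n + n + hi k)) : {poly K}))%N.
  rewrite size_polyXn /q size_polyN; case: ifP => _; first by rewrite mulr0 size_poly0.
  rewrite -exprD size_polyXn ltnS.
  rewrite -[in X in (X < _)%N](subnKC (ltnW (lo_lt_hi k))).
  rewrite -[in X in (_ < X)%N](subnKC (ltnW (lo_lt_hi k))) !expnD.
  have : (1 < D ^ (hi k - lo k))%N by rewrite -(expn0 D) ltn_exp2l // subn_gt0 lo_lt_hi.
  have : (1 < D ^ n)%N.
    rewrite -(expn0 D) ltn_exp2l //; have := ltn_ord (lo k); lia.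
  have : (0 < D ^ lo k)%N by rewrite expn_gt0 (ltnW D1).
  (* With [Q = q * q] the inequality reads [p * r + Q * p < p + Q * p * r], that is,
     [0 < p * (Q - 1) * (r - 1)]. *)
  move: (D ^ lo k)%N (D ^ n)%N (D ^ (hi k - lo k))%N; clear.
  move=> p q r p0 q0 r0.
  have Q : (1 < q * q)%N by nia.
  rewrite -(subnKC (ltnW r0)); have : (0 < r - 1)%N by rewrite subn_gt0.
  move: (q * q)%N (r - 1)%N Q => Q s Q1 s0.
  have : (p * s < Q * (p * s))%N by rewrite ltn_Pmull // muln_gt0 p0.
  nia.
by rewrite monicE lead_coefDl // size_polyDl // lead_coefXn size_polyXn.
Qed.

(** The degree of the image of a monomial has its margins as base-[D] digits, the bound on [D]
    ruling out carries; and margins determine a standard monomial. *)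
Lemma std_poly_indep (f : {mpoly K[nvars n]}) :
  (1 < D)%N -> (forall u, u \in msupp f -> (2 * mdeg u < D)%N) -> std_poly f ->
  (b -> forall u k, u k != 0%N -> (hi k < 2)%N -> f@_u = 0) ->
  mmap (@polyC K) (minors xD yD) f = 0 -> f = 0.
Proof.
move=> D1 degD sf fb; apply: mmap_distinct_degrees_eq0.
  move=> u k uf uk; apply: minors_monic => //; apply/andP => -[bt hk].
  by move: uf; rewrite mcoeff_msupp (fb bt _ _ uk hk) eqxx.
have std u : u \in msupp f -> standard u.
  by rewrite mcoeff_msupp; apply: contraNT => /sf ->.
move=> u v uf vf /=; rewrite !(sum_margin (fun a => D ^ a)%N) => E.
apply: standard_margin_inj; [exact: std|exact: std|].
apply: (base_digits_inj _ _ E) => a; apply: leq_ltn_trans (margin_le _ _) _; exact: degD.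
Qed.

End Independence.
End StandardMonomials.

(** * Regularity of the first coordinate *)

Section IsotropicPlanes.
Variables (K : fieldType) (n : nat).

(** An alternating form on a plane is a multiple of the determinant, so isotropy amounts to one
    equation. *)
Lemma omega_mulmx (M : 'M[K]_(2, n + n)) (a b : 'rV[K]_2) :
  omega (a *m M) (b *m M) = (a 0 0 * b 0 1 - a 0 1 * b 0 0) * sympl_minor (M 0) (M 1).
Proof.
rewrite /omega /sympl_minor mulr_sumr; apply: eq_bigr => k _.
rewrite !mxE !big_ord_recl !big_ord0.
have -> : lift ord0 ord0 = 1 :> 'I_2 by apply: val_inj.
have -> : ord0 = 0 :> 'I_2 by apply: val_inj.
ring.
Qed.

Lemma isotropicP (M : 'M[K]_(2, n + n)) :
  isotropic M <-> sympl_minor (M 0) (M 1) = 0.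
Proof.
split=> [iM|s0 a b]; last by rewrite omega_mulmx s0 mulr0.
have := iM (delta_mx 0 0) (delta_mx 0 1).
by rewrite omega_mulmx !mxE /= mulr1 mul0r subr0 mul1r.
Qed.

Lemma plucker_minors (M : 'M[K]_(2, n + n)) k :
  plucker M (enum_val k) = minors (M 0) (M 1) k.
Proof.
rewrite /plucker (expand_det_row _ 0) !big_ord_recl big_ord0 /cofactor !det_mx11.
rewrite !mxE /= /minors /lo /hi; set a := (val _).1; set b := (val _).2.
have -> : lift 0 0 = 1 :> 'I_2 by apply: val_inj.
rewrite /= /bump /=; ring.
Qed.

Lemma meval_plucker (M : 'M[K]_(2, n + n)) (f : {mpoly K[nvars n]}) :
  f.@[fun i => plucker M (enum_val i)] = mmap (@idfun K) (minors (M 0) (M 1)) f.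
Proof. by apply: meval_eq => k; apply: plucker_minors. Qed.

Lemma relations_S22n f : in_ideal (relations K n) f -> S22n f.
Proof.
move=> If M _ /isotropicP iM; rewrite meval_plucker.
exact: mmap_relations.
Qed.

End IsotropicPlanes.

Section ChartElements.
Variables (n : nat).
Hypothesis n2 : (2 <= n)%N.

Definition e1 : 'I_(n + n) := lshift n (Ordinal (ltnW n2)).
Definition e2 : 'I_(n + n) := lshift n (Ordinal n2).
Definition e1b : 'I_(n + n) := rshift n (Ordinal (ltnW n2)).

Lemma hi_lt2 k : (hi k < 2)%N -> lo k = e1 /\ hi k = e2.
Proof. by have := lo_lt_hi k; split; apply: val_inj => /=; lia. Qed.

Variable K : fieldType.
Local Notation X12 := (Xp K e1 e2).
Local Notation psi b D := (mmap (@polyC K) (minors (xD K D) (yD K b D))).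

Lemma psi_X12 D : psi true D X12 = 0.
Proof. by rewrite mmap_Xp // /yD /= !mulr0 subrr. Qed.

Lemma psi_X12_neq0 D : (1 < D)%N -> psi false D X12 != 0.
Proof.
move=> D1; have [k <- <-] := @pair_index n e1 e2 isT.
rewrite Xp_lo_hi mmapX mmap1U monic_neq0 //.
by have [] := @minors_monic n K false D k D1 isT.
Qed.

(** The summands have degrees [D ^ k + D ^ (n + n + (n + k))], strictly increasing in [k], so they
    do not cancel. Their right ends are at least [n], hence the choice of [b] does not affect
    them. *)
Lemma psi_sympl_neq0 b D : (1 < D)%N -> psi b D (sympl_rel K n) != 0.
Proof.
move=> D1; rewrite /sympl_rel rmorph_sum /=.
have sz k : size (psi b D (Xp K (lshift n k) (rshift n k))) =
    (D ^ k + D ^ (n + n + (n + k))).+1.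
  have [|j lj hj] := @pair_index n (lshift n k) (rshift n k).
    by rewrite /=; have := ltn_ord k; lia.
  rewrite -lj -hj Xp_lo_hi mmapX mmap1U.
  have [|_ ->] := @minors_monic n K b D j D1; last by rewrite lj hj.
  by rewrite hj /= negb_and -leqNgt; lia.
have [||||u _] := @size_sum_distinct K _ (index_enum 'I_n) (fun=> 1)
    (fun k => psi b D (Xp K (lshift n k) (rshift n k))).
- by apply: contraTneq (mem_index_enum (Ordinal n2)) => ->.
- exact: index_enum_uniq.
- by move=> *; apply: oner_neq0.
- move=> k k' _ _; rewrite !sz => -[E]; apply: val_inj => /=.
  have mono a c d : (a < c)%N -> (D ^ (d + a) < D ^ (d + c))%N.
    by move=> ac; rewrite ltn_exp2l // ltn_add2l.
  move: E; rewrite !addnA; case: (ltngtP k k') => // lt_k.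
    by have := mono _ _ 0%N lt_k; have := mono _ _ (n + n + n)%N lt_k; rewrite !add0n; lia.
  by have := mono _ _ 0%N lt_k; have := mono _ _ (n + n + n)%N lt_k; rewrite !add0n; lia.
rewrite -size_poly_gt0 => E; under eq_bigr do rewrite -[mmap _ _ _]scale1r.
by rewrite E sz.
Qed.

(** Straightening leaves a standard polynomial modulo the Plücker relations; if [b] holds, its
    monomials divisible by [X12] are split off. The rest [g0] is still killed by the test
    evaluations, so by independence for large [D] it is zero. *)
Lemma psi_kernel b (h : {mpoly K[nvars n]}) :
  (forall D, (1 < D)%N -> psi b D h = 0) ->
  exists q h', in_ideal (pluckers n K) q /\ h = q + b%:R * X12 * h'.
Proof.
move=> h0; have [g sg Ig] := straighten h.
have [k12 lk hk] := @pair_index n e1 e2 isT.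
have E12 : X12 = 'X_k12 by rewrite -lk -hk Xp_lo_hi.
pose sel (u : 'X_{1..nvars n}) := b && (u k12 != 0%N).
pose g0 := \sum_(u <- msupp g | ~~ sel u) g@_u *: 'X_[u].
have g0E v : (~~ standard v || sel v) -> g0@_v = 0.
  move=> nv; rewrite /g0 raddf_sum /= big1 // => u su.
  rewrite mcoeffZ mcoeffX; case: eqP => [uv|_]; rewrite ?mulr0 // mulr1.
  by case/orP: nv => [/sg|]; rewrite -uv // (negbTE su).
have [h' Eh'] : exists h', g - g0 = b%:R * X12 * h'.
  rewrite {1}(mpolyE g) (bigID sel) /= -/g0 addrK.
  apply: (big_ind (fun f => exists h', f = b%:R * X12 * h')).
  - by exists 0; rewrite mulr0.
  - by move=> _ _ [p ->] [p' ->]; exists (p + p'); rewrite mulrDr.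
  - move=> u /andP[-> uk]; exists (g@_u *: 'X_[u - U_(k12)]).
    rewrite mul1r -scalerAr E12 -mpolyXD addmC submK //.
    by apply/mnm_lepP => i; rewrite mnm1E; case: eqP => // <-; rewrite lt0n.
have psi_g0 D : (1 < D)%N -> psi b D g0 = 0.
  move=> D1; have -> : g0 = h - (h - g) - (g - g0) by ring.
  rewrite mmapB mmapB h0 // (mmap_pluckers _ _ _ Ig) Eh' !rmorphM /= !subr0 sub0r.
  by case: (b) => /=; rewrite ?psi_X12 ?rmorph0 ?mulr0 ?mul0r oppr0.
have g00 : g0 = 0.
  pose D := (2 * \max_(u <- msupp g0) mdeg u).+2.
  apply: (@std_poly_indep n K b D) => //; last exact: psi_g0.
  - move=> u ug; rewrite /D ltnS leqW // leq_mul2l /=.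
    exact: (@bigmaxn_sup_seq _ _ u).
  - by move=> u nu; apply: g0E; rewrite nu.
  - move=> bt u k uk /hi_lt2[l1 h1]; apply: g0E.
    rewrite /sel; have -> : k12 = k by apply: lo_hi_inj; rewrite ?lk ?hk.
    by rewrite bt uk orbT.
exists (h - g), h'; split=> //.
by rewrite -Eh' g00 subr0 subrK.
Qed.

(** The test evaluations with [b = false] land in a domain where [X12] is nonzero, so they kill [f]
    as soon as they kill [X12 * f]. *)
Lemma X12_regular_pluckers f :
  in_ideal (pluckers n K) (X12 * f) -> in_ideal (pluckers n K) f.
Proof.
move=> If; have [|q [h [Iq ->]]] := @psi_kernel false f; last by rewrite !mul0r addr0.
move=> D D1; apply/eqP.
have /eqP := mmap_pluckers (@polyC K) (xD K D) (yD K false D) If.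
by rewrite rmorphM /= mulf_eq0 (negbTE (psi_X12_neq0 D1)).
Qed.

(* Exchange in a regular sequence: [sympl_rel] is regular modulo [X12] and the
   Plücker relations, [X12] modulo the Plücker relations alone. *)
Lemma X12_regular_relations f :
  in_ideal (relations K n) (X12 * f) -> in_ideal (relations K n) f.
Proof.
case/in_ideal_rcons => q [g [Iq E]].
(* Applied to [X12 * f = q + g * sympl_rel K n], the evaluation [psi true D] kills [X12] and [q] but
   not the symplectic relation, so it kills [g]. *)
have [D D1|q' [h [Iq' Eg]]] := @psi_kernel true g.
  have /eqP := congr1 (psi true D) E.
  rewrite rmorphM /= psi_X12 mul0r mmapD mmap_pluckers // add0r rmorphM /=.
  by rewrite eq_sym mulf_eq0 (negbTE (psi_sympl_neq0 _ D1)) orbF => /eqP.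
have sub : {subset pluckers n K <= relations K n}.
  by move=> p; rewrite /relations mem_rcons inE => ->; rewrite orbT.
have If : in_ideal (pluckers n K) (f - h * sympl_rel K n).
  apply: X12_regular_pluckers.
  have -> : X12 * (f - h * sympl_rel K n) = q + q' * sympl_rel K n.
    by rewrite mulrBr E Eg mul1r; ring.
  by apply: in_idealD => //; apply: in_idealMr.
rewrite -(subrK (h * sympl_rel K n) f); apply: in_idealD.
  exact: in_ideal_subset If.
by apply/in_idealMl/in_ideal_mem; rewrite mem_rcons mem_head.
Qed.

End ChartElements.

(** * The chart of the isotropic Grassmannian *)

Section Chart.
Variables (n : nat) (n2 : (2 <= n)%N) (K : closedFieldType).
Local Notation X12 := (Xp K (e1 n2) (e2 n2)).
Local Notation J := (in_ideal (relations K n)).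
Implicit Types f g h : {mpoly K[nvars n]}.

(* The coordinates that stay free on the chart [X12 != 0] of the isotropic
   Grassmannian; there the symplectic relation is solved for [X_{1 1bar}]. *)
Definition chart_var (k : 'I_(nvars n)) : bool :=
  (lo k < 2)%N && ~~ ((lo k == 0 :> nat) && (hi k == n :> nat)).

(** Dependence on the chart variables alone is expressed through values, which makes closure under
    sums and products immediate. *)
Definition chart_poly h : Prop := forall z z' : 'I_(nvars n) -> K,
  (forall k, chart_var k -> z k = z' k) -> h.@[z] = h.@[z'].

(** Modulo the relations and after inverting [X12], [f] comes from the chart variables. *)
Definition chart_reducible f : Prop :=
  exists N h, J (X12 ^+ N * f - h) /\ chart_poly h.

Lemma chart_var_X12 k : lo k = e1 n2 -> hi k = e2 n2 -> chart_var k.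
Proof. by rewrite /chart_var => -> -> /=; lia. Qed.

Lemma chart_poly_X12 : chart_poly X12.
Proof.
have [k lk hk] := @pair_index n (e1 n2) (e2 n2) isT.
have ck := chart_var_X12 lk hk.
by move=> z z' zz'; rewrite -lk -hk Xp_lo_hi !mevalXU zz'.
Qed.

Lemma chart_polyD f g : chart_poly f -> chart_poly g -> chart_poly (f + g).
Proof. by move=> cf cg z z' zz'; rewrite !mevalD (cf z z') // (cg z z'). Qed.

Lemma chart_polyM f g : chart_poly f -> chart_poly g -> chart_poly (f * g).
Proof. by move=> cf cg z z' zz'; rewrite !mevalM (cf z z') // (cg z z'). Qed.

Lemma chart_polyXn N : chart_poly (X12 ^+ N).
Proof. by move=> z z' zz'; rewrite !rmorphXn /= (chart_poly_X12 zz'). Qed.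

Lemma chart_poly_reducible h : chart_poly h -> chart_reducible h.
Proof. by exists 0%N, h; rewrite expr0 mul1r subrr; split=> //; apply: in_ideal0. Qed.

Lemma chart_reducibleD f g :
  chart_reducible f -> chart_reducible g -> chart_reducible (f + g).
Proof.
move=> [N [h [If ch]]] [N' [h' [If' ch']]].
exists (N + N')%N, (X12 ^+ N' * h + X12 ^+ N * h'); split.
  have := in_idealD (in_idealMl (X12 ^+ N') If) (in_idealMl (X12 ^+ N) If').
  by congr in_ideal; rewrite exprD; ring.
by apply: chart_polyD; apply: chart_polyM => //; apply: chart_polyXn.
Qed.

Lemma chart_reducibleM f g :
  chart_reducible f -> chart_reducible g -> chart_reducible (f * g).
Proof.
move=> [N [h [If ch]]] [N' [h' [If' ch']]].
exists (N + N')%N, (h * h'); split; last exact: chart_polyM.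
have := in_idealD (in_idealMl (X12 ^+ N' * g) If) (in_idealMl h If').
by congr in_ideal; rewrite exprD; ring.
Qed.

Lemma chart_reducibleC c : chart_reducible c%:MP.
Proof. by apply: chart_poly_reducible => z z' _; rewrite !mevalC. Qed.

Lemma chart_reducibleN f : chart_reducible f -> chart_reducible (- f).
Proof.
move=> cf; have -> : - f = (-1)%:MP * f by rewrite rmorphN /= mulNr mul1r.
by apply: chart_reducibleM => //; apply: chart_reducibleC.
Qed.

Lemma chart_reducible_mod f g : J (f - g) -> chart_reducible g -> chart_reducible f.
Proof.
move=> Ifg [N [h [Ig ch]]]; exists N, h; split=> //.
have := in_idealD (in_idealMl (X12 ^+ N) Ifg) Ig.
by congr in_ideal; ring.
Qed.

Lemma chart_reducible_X12M f : chart_reducible (X12 * f) -> chart_reducible f.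
Proof.
by move=> [N [h [If ch]]]; exists N.+1, h; split=> //; rewrite exprSr -mulrA.
Qed.

Lemma pluckers_relations f : in_ideal (pluckers n K) f -> J f.
Proof. by apply: in_ideal_subset => p; rewrite mem_rcons inE => ->; rewrite orbT. Qed.

Lemma chart_reducible_low (i j : 'I_(n + n)) : (i < 2)%N -> (i < j)%N ->
  ~~ ((i == 0 :> nat) && (j == n :> nat)) -> chart_reducible (Xp K i j).
Proof.
move=> i2 /pair_index[k lk hk] nij; apply: chart_poly_reducible => z z' zz'.
rewrite -lk -hk Xp_lo_hi !mevalXU zz' // /chart_var lk hk i2.
exact: nij.
Qed.

(** The Plücker relation on [1, 2, i, j] gives [X12 * X_ij = X_1i * X_2j - X_1j * X_2i]. *)
Lemma chart_reducible_high (i j : 'I_(n + n)) : (2 <= i)%N -> (i < j)%N ->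
  chart_reducible (Xp K (e1 n2) i) -> chart_reducible (Xp K (e1 n2) j) ->
  chart_reducible (Xp K i j).
Proof.
move=> i2 ij ci cj; apply: chart_reducible_X12M.
have c2 (l : 'I_(n + n)) : (2 <= l)%N -> chart_reducible (Xp K (e2 n2) l).
  by move=> l2; apply: chart_reducible_low.
apply: (@chart_reducible_mod _ (Xp K (e1 n2) i * Xp K (e2 n2) j -
                                Xp K (e1 n2) j * Xp K (e2 n2) i)).
  apply: pluckers_relations.
  have := in_ideal_mem (@plucker_rel_in n K (e1 n2) (e2 n2) i j isT i2 ij).
  by congr in_ideal; rewrite /plucker_rel; ring.
apply: chart_reducibleD; last apply: chart_reducibleN.
  by apply: chart_reducibleM => //; apply: c2; lia.
by apply: chart_reducibleM => //; apply: c2; lia.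
Qed.

(** The symplectic relation trades this variable for the other summands. Reducing those uses only
    chart variables, as the pairs [1 k] and [1 kbar] with [k] other than [1] avoid [1 1bar]; so
    there is no circularity. *)
Lemma chart_reducible_e1b : chart_reducible (Xp K (e1 n2) (e1b n2)).
Proof.
pose o1 : 'I_n := Ordinal (ltnW n2).
apply: (@chart_reducible_mod _
  (- \sum_(k < n | k != o1) Xp K (lshift n k) (rshift n k))).
  have : J (sympl_rel K n) by apply: in_ideal_mem; rewrite mem_rcons mem_head.
  by congr in_ideal; rewrite /sympl_rel (bigD1 o1) //= opprK.
apply: chart_reducibleN; apply: big_ind => [||k].
- by rewrite -mpolyC0; apply: chart_reducibleC.
- exact: chart_reducibleD.
rewrite -val_eqE /= => k0; have kn := ltn_ord k.
have [k2|k2] := ltnP k 2; first by apply: chart_reducible_low => //=; lia.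
by apply: chart_reducible_high => //=; [lia | | ]; apply: chart_reducible_low => //=; lia.
Qed.

Lemma chart_reducible_all f : chart_reducible f.
Proof.
have c1 (j : 'I_(n + n)) : (0 < j)%N -> chart_reducible (Xp K (e1 n2) j).
  move=> j0; have [jn|jn] := eqVneq (j : nat) n; last first.
    by apply: chart_reducible_low => //=; rewrite negb_and jn.
  have -> : j = e1b n2 by apply: val_inj; rewrite /= jn addn0.
  exact: chart_reducible_e1b.
elim/mpoly_subring_ind: f => [c|k|f g|f g].
- exact: chart_reducibleC.
- rewrite -Xp_lo_hi; have lh := lo_lt_hi k.
  have [k2|k2] := ltnP (lo k) 2.
    have [k0|k0] := eqVneq (lo k : nat) 0%N.
      by have -> : lo k = e1 n2 by [apply: val_inj]; apply: c1; lia.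
    by apply: chart_reducible_low; rewrite ?negb_and ?k0.
  by apply: chart_reducible_high => //; apply: c1; lia.
- exact: chart_reducibleD.
- exact: chart_reducibleM.
Qed.

(* On the chart the rows are normalized to [(1, 0, ..)] and [(0, z12, ..)],
   and isotropy determines the [1bar] entry of the second row. *)
Lemma chart_point (z : 'I_(nvars n) -> K) k12 :
  lo k12 = e1 n2 -> hi k12 = e2 n2 -> z k12 != 0 ->
  exists M : 'M[K]_(2, n + n), [/\ \rank M = 2%N, isotropic M &
    forall k, chart_var k -> minors (M 0) (M 1) k = z k].
Proof.
move=> l12 h12 z0; set a := z k12.
pose zz (i j : 'I_(n + n)) := if insub (i, j) is Some P then z (enum_rank (P : pairs n)) else 0.
have zzE k : zz (lo k) (hi k) = z k by rewrite /zz insub_lo_hi enum_valK.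
(* The entries are forced: the minor [1 j] is [y j], and the minor [2 j] is [- x j * a]. *)
pose x (j : 'I_(n + n)) := if (j : nat) == 0%N then 1 else
  if (j : nat) == 1%N then 0 else - zz (e2 n2) j / a.
pose y0 (j : 'I_(n + n)) := if (j : nat) == 0%N then 0 else zz (e1 n2) j.
pose o1 : 'I_n := Ordinal (ltnW n2).
(* The pairs other than [1, 1bar] contribute [s] to the form; since [x] is [1] at the first index,
   the entry [- s] at position [n], which is [1bar], cancels it. *)
pose s := \sum_(k < n | k != o1)
  (x (lshift n k) * y0 (rshift n k) - x (rshift n k) * y0 (lshift n k)).
pose y (j : 'I_(n + n)) := if (j : nat) == n then - s else y0 j.
pose M : 'M[K]_(2, n + n) := \matrix_(i, j) (if i == 0 then x j else y j).
have M0 j : M 0 j = x j by rewrite mxE.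
have M1 j : M 1 j = y j by rewrite mxE.
have x1 : x (e1 n2) = 1 by [].
have x2 : x (e2 n2) = 0 by [].
have y1 : y (e1 n2) = 0 by rewrite /y /=; case: eqP => //; lia.
have y2 : y (e2 n2) = a.
  rewrite /y /=; case: eqP => [|_]; first lia.
  by rewrite /y0 /= -{1}l12 -h12 zzE.
exists M; split.
- apply/eqP; apply/row_freeP.
  exists (\matrix_(i, j) (if i == e1 n2 then (j == 0)%:R else
                          if i == e2 n2 then (j == 1)%:R / a else 0)).
  apply/matrixP => i j; rewrite !mxE (bigD1 (e1 n2)) //= (bigD1 (e2 n2)) //= big1.
    rewrite !mxE eqxx /= ?eqxx x1 x2 y1 y2 addr0.
    case: ifP => i0; rewrite ?mul0r ?mul1r ?addr0 ?add0r.
      by rewrite (eqP i0) eq_sym.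
    have -> : i = 1 by apply: val_inj; case: i i0 => -[|[|[]]].
    by rewrite mulrCA divff // mulr1 eq_sym.
  by move=> l /andP[/negbTE l1 /negbTE l2]; rewrite !mxE l1 l2 mulr0.
- apply/isotropicP; rewrite /sympl_minor (bigD1 o1) //= !M0 !M1.
  rewrite -/(e1 n2) -/(e1b n2) x1 y1 mulr0 subr0 mul1r.
  have -> : y (e1b n2) = - s by rewrite /y /= addn0 eqxx.
  apply/eqP; rewrite addrC subr_eq0; apply/eqP; apply: eq_bigr => k.
  rewrite -val_eqE /= => k0; rewrite !M0 !M1.
  have -> : y (rshift n k) = y0 (rshift n k) by rewrite /y /=; case: eqP => //; lia.
  have -> // : y (lshift n k) = y0 (lshift n k).
  by rewrite /y /=; case: eqP => //; have := ltn_ord k; lia.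
- move=> k /andP[lk2 nk]; rewrite /minors !M0 !M1; have lh := lo_lt_hi k.
  have [l0|l0] := eqVneq (lo k : nat) 0%N.
    have El : lo k = e1 n2 by apply: val_inj.
    rewrite El x1 y1 mulr0 subr0 mul1r -zzE El.
    rewrite l0 /= in nk; rewrite /y (negbTE nk) /y0.
    by case: eqP => // h0; rewrite h0 in lh.
  have El : lo k = e2 n2 by apply: val_inj => /=; lia.
  rewrite El x2 y2 mul0r sub0r -zzE El /x.
  case: eqP => [|_]; first lia.
  case: eqP => [h1|_]; first by move: lh; rewrite El h1.
  by rewrite mulfVK // opprK.
Qed.

(** Modulo the relations [X12 ^+ N * f] is a chart polynomial [h]. Every point with [X12] nonzero
    agrees on the chart variables with the minors of an isotropic plane, so [h] vanishes there;
    hence [h] is zero, and the powers of [X12] cancel by regularity. *)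
Lemma S22n_relations f : S22n f -> J f.
Proof.
move=> Sf; have [N [h [Jh ch]]] := chart_reducible_all f.
have [k12 l12 h12] := @pair_index n (e1 n2) (e2 n2) isT.
have E12 : X12 = 'X_k12 by rewrite -l12 -h12 Xp_lo_hi.
have : X12 * h = 0.
  apply: meval_eq0 => z; rewrite mevalM E12 mevalXU.
  have [->|z0] := eqVneq (z k12) 0; first by rewrite mul0r.
  have [M [rM iM zM]] := chart_point l12 h12 z0.
  have cM : h.@[minors (M 0) (M 1)] = h.@[z] by apply: ch.
  have := mmap_relations (@idfun K) Jh (iffLR (isotropicP M) iM).
  have := Sf M rM iM; rewrite meval_plucker => f0.
  rewrite mmapB rmorphM /= f0 mulr0 sub0r => /eqP; rewrite oppr_eq0 => /eqP h0.
  by rewrite -cM /meval h0 mulr0.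
move/eqP; rewrite mulf_eq0 E12 -msupp_eq0 msuppX /= => /eqP h0.
move: Jh; rewrite h0 subr0; elim: N => [|N IH]; first by rewrite expr0 mul1r.
by rewrite exprS -mulrA => /X12_regular_relations.
Qed.

End Chart.

(** * Valuations on commutative rings *)

Ltac trop_cases :=
  intros; repeat match goal with x : trop |- _ => destruct x end;
  cbn [tadd tle tmin] in *;
  repeat match goal with H : Some _ = Some _ |- _ => injection H; clear H; intros end;
  try discriminate; try exact I; try contradiction; try tauto;
  unfold Rmin in *;
  repeat match goal with
  | |- context [Rle_dec ?a ?b] => destruct (Rle_dec a b)
  | _ : context [Rle_dec ?a ?b] |- _ => destruct (Rle_dec a b)
  end;
  try (apply f_equal); try lra; try tauto.

Ltac trop_lra := clear; trop_cases.

Lemma tle_refl x : tle x x. Proof. by trop_lra. Qed.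
Lemma tle_trans x y z : tle x y -> tle y z -> tle x z. Proof. by trop_lra. Qed.
Lemma tle_anti x y : tle x y -> tle y x -> x = y. Proof. by trop_lra. Qed.
Lemma tle_total x y : tle x y \/ tle y x.
Proof. by case: x y => [a|] [b|] //=; try tauto; have [] := Rle_or_lt a b; lra. Qed.
Lemma tle_minP x y z : tle x (tmin y z) <-> tle x y /\ tle x z.
Proof. by split; [move=> h; split; move: h; trop_lra | case; trop_lra]. Qed.
Lemma taddC x y : tadd x y = tadd y x. Proof. by trop_lra. Qed.
Lemma tadd0 x : tadd x (Some R0) = x. Proof. by trop_lra. Qed.
Lemma tmin_choice x y : tmin x y = x \/ tmin x y = y.
Proof.
case: x y => [a|] [b|] /=; try tauto.
by rewrite /Rmin; case: Rle_dec; tauto.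
Qed.

(** The strict bound [a < x] is written [~ tle x (Some a)], which includes infinite [x]. *)
Lemma tgt_min x y z a : tle (tmin x y) z ->
  ~ tle x (Some a) -> ~ tle y (Some a) -> ~ tle z (Some a).
Proof. by move: x y z; trop_lra. Qed.

Lemma tmin_lt_eq x y z : tle (tmin z y) x -> tle (tmin x y) z -> ~ tle y x -> z = x.
Proof. by move: x y z; trop_lra. Qed.

(** Here and in the next two lemmas [c] stands for the weight [INR k * r] of an exponent [k] in a
    Gauss valuation. *)
Lemma tadd_shift_ge x y z a b c : tadd x (Some c) = tadd y z ->
  tle (Some b) z -> tle (Some a) y -> tle (Some (Rminus (Rplus a b) c)) x.
Proof. by move: x y z; trop_lra. Qed.

Lemma tadd_shift_gt x y z a b c d : tadd x (Some c) = tadd y z ->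
  Rplus d c = Rplus a b -> tle x (Some d) -> tle (Some b) z -> tle (Some a) y ->
  tle y (Some a) /\ tle z (Some b).
Proof. by move: x y z; trop_lra. Qed.

Lemma tadd_shift_min x y p q s c : tle x (tadd p (Some c)) -> tle y (tadd q (Some c)) ->
  tle (tmin p q) s -> tle (tmin x y) (tadd s (Some c)).
Proof. by move: x y p q s; trop_lra. Qed.

Definition teqb (x y : trop) : bool :=
  match x, y with
  | Some a, Some b => if Req_EM_T a b then true else false
  | None, None => true
  | _, _ => false
  end.

Lemma teqP x y : reflect (x = y) (teqb x y).
Proof.
case: x y => [a|] [b|] /=; try by constructor.
by case: Req_EM_T => ab /=; constructor; [rewrite ab | case].
Qed.

Lemma bigtmin_le (T : eqType) (s : seq T) (F : T -> trop) t :
  t \in s -> tle (\big[tmin/None]_(i <- s) F i) (F t).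
Proof.
elim: s => [//|a s IH]; rewrite inE big_cons => ts.
have /tle_minP[le1 le2] := tle_refl (tmin (F a) (\big[tmin/None]_(i <- s) F i)).
by case/predU1P: ts => [->//|/IH]; apply: tle_trans.
Qed.

Lemma bigtmin_attained (T : eqType) (s : seq T) (F : T -> trop) :
  s != [::] -> exists2 t, t \in s & \big[tmin/None]_(i <- s) F i = F t.
Proof.
elim: s => [//|a s IH] _; rewrite big_cons.
have [->|/IH[t ts ->]] := eqVneq s [::].
  by exists a; rewrite ?mem_head // big_nil; case: (F a).
have [->|->] := tmin_choice (F a) (F t); first by exists a; rewrite ?mem_head.
by exists t; rewrite // inE ts orbT.
Qed.

Lemma seq_argmax (T : eqType) (s : seq T) (F : T -> trop) : s != [::] ->
  exists2 t, t \in s & forall t', t' \in s -> tle (F t') (F t).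
Proof.
elim: s => [//|a s IH] _.
have [->|/IH[t ts tmax]] := eqVneq s [::].
  by exists a; rewrite ?mem_head // => t; rewrite inE => /eqP ->; apply: tle_refl.
have [le_at|le_ta] := tle_total (F a) (F t).
  exists t; first by rewrite inE ts orbT.
  by move=> t'; rewrite inE => /predU1P[->|/tmax].
exists a; first by rewrite mem_head.
move=> t'; rewrite inE => /predU1P[->|/tmax]; first exact: tle_refl.
by move=> /tle_trans; apply.
Qed.

(** The axioms of [is_valuation] over commutative rings, so that towers of polynomial rings can
    serve as valued extensions. *)
Definition ring_valuation (A : comNzRingType) (v : A -> trop) : Prop :=
  [/\ forall x, v x = None <-> x = 0,
      forall x y, v (x * y) = tadd (v x) (v y) &
      forall x y, tle (tmin (v x) (v y)) (v (x + y))].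

Section RingValuation.
Variables (A : comNzRingType) (v : A -> trop).
Hypothesis vP : ring_valuation v.

Lemma val0 : v 0 = None. Proof. by case: vP => v0 _ _; apply/v0. Qed.
Lemma valM x y : v (x * y) = tadd (v x) (v y). Proof. by case: vP. Qed.
Lemma val_eq0 x : v x = None -> x = 0. Proof. by case: vP => v0 _ _ /v0. Qed.
Lemma valD x y : tle (tmin (v x) (v y)) (v (x + y)). Proof. by case: vP. Qed.

Lemma val1 : v 1 = Some R0.
Proof.
have := valM 1 1; rewrite mulr1; case E : (v 1) => [a|] /=.
  by case=> Ea; congr Some; lra.
by move/val_eq0/eqP: E; rewrite oner_eq0.
Qed.

Lemma valN1 : v (-1) = Some R0.
Proof.
have := valM (-1) (-1); rewrite mulrNN mulr1 val1; case: (v _) => [a|] //= [Ea].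
by congr Some; lra.
Qed.

Lemma valN x : v (- x) = v x.
Proof. by rewrite -mulN1r valM valN1 taddC tadd0. Qed.

Lemma valB_sym x y : v (x - y) = v (y - x).
Proof. by rewrite -valN opprB. Qed.

Lemma val_sum_ge (T : Type) (s : seq T) (P : pred T) (F : T -> A) a :
  (forall t, P t -> tle a (v (F t))) -> tle a (v (\sum_(t <- s | P t) F t)).
Proof.
move=> aF; apply: (big_ind (fun x => tle a (v x))) => [|x y ax ay|//].
  by rewrite val0; case: a aF.
by apply: tle_trans (valD x y); apply/tle_minP.
Qed.

Lemma val_sum_gt (T : eqType) (s : seq T) (P : pred T) (F : T -> A) a :
  (forall t, t \in s -> P t -> ~ tle (v (F t)) (Some a)) ->
  ~ tle (v (\sum_(t <- s | P t) F t)) (Some a).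
Proof.
move=> aF; rewrite big_seq_cond.
apply: (big_ind (fun x => ~ tle (v x) (Some a))) => [|x y|t /andP[]]; last exact: aF.
  by rewrite val0.
exact: tgt_min (valD x y).
Qed.

Lemma valD_lt x y : ~ tle (v y) (v x) -> v (x + y) = v x.
Proof.
by have := valD (x + y) (- y); rewrite addrK valN => /tmin_lt_eq; apply; apply: valD.
Qed.

Lemma valX x k : v (x ^+ k) = tscale k (v x).
Proof.
case: k => [|k]; first by rewrite expr0 val1.
rewrite /tscale /=; elim: k => [|k IH].
  by rewrite expr1; case: (v x) => // a; rewrite Rmult_1_l.
rewrite exprS valM IH; case: (v x) => //= a; congr Some.
rewrite -/(INR k.+1) -/(INR k.+2) (S_INR k.+1); lra.
Qed.

Lemma val_prod (T : Type) (s : seq T) (F : T -> A) :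
  v (\prod_(t <- s) F t) = foldr tadd (Some R0) [seq v (F t) | t <- s].
Proof. by elim: s => [|a s IH]; rewrite ?big_nil ?val1 // big_cons valM IH. Qed.

(** If a finite minimum were attained at [t] only, the other summands would add up to something of
    larger value; but their sum is [- F t]. *)
Lemma val_sum0 (T : eqType) (s : seq T) (F : T -> A) :
  uniq s -> \sum_(t <- s) F t = 0 ->
  (forall t, t \in s -> v (F t) = None) \/
  exists t t', [/\ t \in s, t' \in s, t != t', v (F t) = v (F t') &
                   forall t'', t'' \in s -> tle (v (F t)) (v (F t''))].
Proof.
move=> Us F0; have [->|s0] := eqVneq s [::]; first by left.
have [t ts Et] := bigtmin_attained (fun t => v (F t)) s0.
have tmin t' : t' \in s -> tle (v (F t)) (v (F t')).
  by move=> t's; rewrite -Et; apply: bigtmin_le.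
case Ev : (v (F t)) => [a|]; last first.
  by left=> t' /tmin; rewrite Ev; case: (v (F t')).
right; have [/hasP[t' t's /andP[tt' /teqP Et']]|/hasPn none] :=
  boolP (has (fun t' => (t != t') && teqb (v (F t)) (v (F t'))) s).
  by exists t, t'; split=> // t'' t''s; rewrite -Ev; apply: tmin.
move: F0; rewrite (bigD1_seq t) //= => /eqP; rewrite addr_eq0 => /eqP E.
have := @val_sum_gt _ s (fun t' => t' != t) F a.
move/(_ _)=> H; exfalso; apply: H => [t' t's tt'|].
  move=> le_t'; have := none _ t's; rewrite eq_sym tt' /= => /teqP; apply.
  by apply: tle_anti; [apply: tmin | rewrite Ev].
by rewrite -valN -E Ev; apply: tle_refl.
Qed.

End RingValuation.

(** * Gauss valuations on univariate polynomials *)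

Section GaussValuation.
Variables (A : comNzRingType) (v : A -> trop) (r : R).
Hypothesis vP : ring_valuation v.

Definition gauss_term (f : {poly A}) (i : nat) : trop :=
  tadd (v f`_i) (Some (Rmult (INR i) r)).

Definition gauss_val (f : {poly A}) : trop :=
  \big[tmin/None]_(i <- iota 0 (size f)) gauss_term f i.

Lemma gauss_val_le f i : tle (gauss_val f) (gauss_term f i).
Proof.
have [lt_i|ge_i] := ltnP i (size f); first by apply: bigtmin_le; rewrite mem_iota.
by rewrite /gauss_term nth_default // (val0 vP); case: gauss_val.
Qed.

Lemma gauss_val_ge f a : (forall i, tle a (gauss_term f i)) -> tle a (gauss_val f).
Proof.
move=> af; apply: (big_ind (tle a)) => [|x y|i _]; [by case: a af | | exact: af].
by move=> ax ay; apply/tle_minP.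
Qed.

Lemma gauss_val0 : gauss_val 0 = None.
Proof. by rewrite /gauss_val size_poly0 big_nil. Qed.

Lemma gauss_val_attained f : f != 0 ->
  exists a i, [/\ gauss_val f = Some a, gauss_term f i = Some a &
    forall j, (j < i)%N -> ~ tle (gauss_term f j) (Some a)].
Proof.
move=> f0; have s0 : iota 0 (size f) != [::] by rewrite -size_eq0 size_iota size_poly_eq0.
have [i0 _ Ei0] := bigtmin_attained (gauss_term f) s0.
have ex : exists i, teqb (gauss_term f i) (gauss_val f) by exists i0; apply/teqP.
case: (ex_minnP ex) => i /teqP Ei imin.
case Ea : (gauss_val f) => [a|]; last first.
  have := gauss_val_le f (size f).-1; rewrite Ea /gauss_term.
  have : v f`_(size f).-1 <> None.
    by move/(val_eq0 vP)/eqP; rewrite -/(lead_coef f) lead_coef_eq0 (negbTE f0).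
  by case: (v _).
exists a, i; split; rewrite -?Ea // => j ji le_j.
suff /imin : teqb (gauss_term f j) (gauss_val f) by rewrite leqNgt ji.
by apply/teqP/tle_anti => //; apply: gauss_val_le.
Qed.

Lemma gauss_termM (f g : {poly A}) i j :
  tadd (v (f`_i * g`_j)) (Some (Rmult (INR (i + j)) r)) =
  tadd (gauss_term f i) (gauss_term g j).
Proof.
rewrite /gauss_term (valM vP) plus_INR.
by case: (v f`_i) (v g`_j) => [a|] [b|] //=; congr Some; lra.
Qed.

(** Let [i] and [j] be the first indices where [f] and [g] attain their minima. In the coefficient
    [i + j] of the product, only [f_i * g_j] has the least value, so it cannot be cancelled. *)
Lemma gauss_val_mul f g : gauss_val (f * g) = tadd (gauss_val f) (gauss_val g).
Proof.
have [->|f0] := eqVneq f 0; first by rewrite mul0r gauss_val0.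
have [->|g0] := eqVneq g 0; first by rewrite mulr0 gauss_val0; case: gauss_val.
have [a [i [Ef Ei mini]]] := gauss_val_attained f0.
have [b [j [Eg Ej minj]]] := gauss_val_attained g0.
rewrite Ef Eg; apply: tle_anti; last first.
  apply: gauss_val_ge => k; rewrite /gauss_term coefM.
  suff : tle (Some (Rminus (Rplus a b) (Rmult (INR k) r)))
     (v (\sum_(l < k.+1) f`_l * g`_(k - l))) by case: (v _) => //= c; lra.
  apply: (val_sum_ge vP) => l _.
  have lk : (l <= k)%N by rewrite -ltnS.
  have := gauss_termM f g l (k - l); rewrite subnKC // => /tadd_shift_ge.
  by apply; rewrite -?Ef -?Eg; apply: gauss_val_le.
suff <- : gauss_term (f * g) (i + j) = tadd (Some a) (Some b) by apply: gauss_val_le.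
have lt_i : (i < (i + j).+1)%N by rewrite ltnS leq_addr.
rewrite /gauss_term coefM (bigD1 (Ordinal lt_i)) //= addKn.
have E0 := gauss_termM f g i j; rewrite Ei Ej in E0.
rewrite (valD_lt vP) // => le_s; case Ec : (v (f`_i * g`_j)) le_s E0 => [c|//] le_s [E0].
apply: (val_sum_gt vP) le_s => l _; rewrite -val_eqE /= => li le_l.
have lk : (l <= i + j)%N by rewrite -ltnS.
have := gauss_termM f g l (i + j - l); rewrite subnKC // => E.
have [||le_f le_g] := tadd_shift_gt E E0 le_l.
- by rewrite -Eg; apply: gauss_val_le.
- by rewrite -Ef; apply: gauss_val_le.
have [lt_l|le_il] := ltnP l i; first exact: mini le_f.
by apply: minj le_g; lia.
Qed.

Lemma gauss_valuation : ring_valuation gauss_val.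
Proof.
split; first (move=> f; split=> [fN|->]; last exact: gauss_val0).
- by apply/eqP/negPn/negP => /gauss_val_attained[a [i [Ea]]]; rewrite fN in Ea.
- exact: gauss_val_mul.
- move=> f g; apply: gauss_val_ge => i; rewrite /gauss_term coefD.
  exact: tadd_shift_min (gauss_val_le f i) (gauss_val_le g i) (valD vP _ _).
Qed.

Lemma gauss_val_linear c d :
  gauss_val (c%:P + d%:P * 'X) = tmin (v c) (tadd (v d) (Some r)).
Proof.
have E0 : gauss_term (c%:P + d%:P * 'X) 0 = v c.
  by rewrite /gauss_term coefD coefC coefMX /= addr0 Rmult_0_l tadd0.
have E1 : gauss_term (c%:P + d%:P * 'X) 1 = tadd (v d) (Some r).
  by rewrite /gauss_term coefD coefC coefMX coefC /= add0r Rmult_1_l.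
apply: tle_anti.
  by apply/tle_minP; rewrite -E0 -E1; split; apply: gauss_val_le.
have /tle_minP[le1 le2] := tle_refl (tmin (v c) (tadd (v d) (Some r))).
apply: gauss_val_ge => -[|[|i]]; rewrite ?E0 ?E1 //.
by rewrite /gauss_term coefD coefC coefMX coefC /= addr0 (val0 vP); case: (tmin _ _).
Qed.

Lemma gauss_valC c : gauss_val c%:P = v c.
Proof.
have := gauss_val_linear c 0; rewrite mul0r addr0 (val0 vP) => ->.
by case: (v c).
Qed.

End GaussValuation.

(** * Realization over valued extensions *)

Record valued_ext (A0 : comNzRingType) (v0 : A0 -> trop) := ValuedExt {
  vring : comNzRingType;
  vval : vring -> trop;
  vemb : {rmorphism A0 -> vring};
  vvalP : ring_valuation vval;
  vembE : forall x, vval (vemb x) = v0 x }.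

Section Realization.
Variables (A0 : comNzRingType) (v0 : A0 -> trop).
Implicit Types E : valued_ext v0.

Definition adjoin E (r : R) : valued_ext v0.
Proof.
refine (@ValuedExt _ _ _ (gauss_val (@vval _ _ E) r)
  (@polyC (vring E) \o @vemb _ _ E : {rmorphism A0 -> {poly vring E}}) _ _).
- exact: gauss_valuation (@vvalP _ _ E).
- by move=> x /=; rewrite gauss_valC ?vembE //; exact: vvalP.
Defined.

(** The formula says that [t] is generic of value [r]: no cancellation occurs in [c + d * t]. All
    later extensions are built from this statement. *)
Lemma exists_adjoin E (r : R) :
  exists E' (j : {rmorphism vring E -> vring E'}) (t : vring E'),
    (forall a, vval (j a) = vval a) /\
    forall c d, vval (j c + j d * t) = tmin (vval c) (tadd (vval d) (Some r)).
Proof.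
exists (adjoin E r), (@polyC (vring E) : {rmorphism vring E -> {poly vring E}}), 'X.
split=> [a|c d] /=; first exact: gauss_valC (@vvalP _ _ E) _.
exact: gauss_val_linear (@vvalP _ _ E) _ _.
Qed.

Lemma realize_scalars (T : eqType) (t : T -> trop) (s : seq T) E :
  exists E' (j : {rmorphism vring E -> vring E'}) (a : T -> vring E'),
    (forall a, vval (j a) = vval a) /\ forall i, i \in s -> vval (a i) = t i.
Proof.
elim: s => [|m s [E1 [j1 [a [vj1 va]]]]].
  by exists E, (idfun : {rmorphism vring E -> vring E}), (fun=> 0).
case Et : (t m) => [r|]; last first.
  exists E1, j1, (fun i => if i == m then 0 else a i); split=> // i.
  rewrite inE; case: eqP => [-> _|_] /=; last exact: va.
  by rewrite Et; apply: val0 (@vvalP _ _ E1).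
have [E2 [j2 [x [vj2 vx]]]] := exists_adjoin E1 r.
exists E2, (j2 \o j1 : {rmorphism vring E -> vring E2}), (fun i => if i == m then x else j2 (a i)).
split=> [b|i]; first by rewrite /= vj2 vj1.
rewrite inE; case: eqP => [-> _|_] /= => [|si]; last by rewrite vj2 va.
have := vx 0 1; rewrite !rmorph0 rmorph1 add0r mul1r Et => ->.
by rewrite (val0 (@vvalP _ _ E1)) (val1 (@vvalP _ _ E1)) /= Rplus_0_l.
Qed.

(* A new point is placed at a generic point of the ball around its nearest
   predecessor. *)
Lemma realize_ultrametric (T : eqType) (d : T -> T -> trop) (s : seq T) E :
  (forall i j, d i j = d j i) ->
  (forall i j k, i \in s -> j \in s -> k \in s -> i != j -> j != k -> i != k ->
     tle (tmin (d i k) (d k j)) (d i j)) ->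
  exists E' (j : {rmorphism vring E -> vring E'}) (a : T -> vring E'),
    (forall a, vval (j a) = vval a) /\
    forall i k, i \in s -> k \in s -> i != k -> vval (a i - a k) = d i k.
Proof.
move=> dC; elim: s => [|m s IH] ud.
  by exists E, (idfun : {rmorphism vring E -> vring E}), (fun=> 0).
have [|E1 [j1 [a [vj1 va]]]] := IH.
  by move=> i j k si sj sk; apply: ud; rewrite inE ?si ?sj ?sk orbT.
have [ms|ms] := boolP (m \in s).
  exists E1, j1, a; split=> // i k; rewrite !inE => mi mk.
  by apply: va; [case/predU1P: mi => [->|] | case/predU1P: mk => [->|]].
have [s0|s0] := eqVneq s [::].
  exists E1, j1, a; split=> // i k; rewrite s0 !inE => /eqP-> /eqP->.
  by rewrite eqxx.
have [k sk kmax] := seq_argmax (d m) s0.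
have neqm i : i \in s -> i != m by apply: contraTneq => ->.
(* As [d m k] is largest, the ultrametric inequalities in the triangle [m, i, k] force [d m i]. *)
have dm i : i \in s -> i != k -> tmin (d i k) (d m k) = d m i.
  move=> si ik; have := kmax _ si.
  have ims := neqm _ si; have kms := neqm _ sk.
  have := ud m i k; rewrite !inE eqxx si sk !orbT ik eq_sym ims eq_sym kms.
  move=> /(_ isT isT isT isT isT isT).
  have := ud i k m; rewrite !inE eqxx si sk !orbT ik ims kms => /(_ isT isT isT isT isT isT).
  rewrite (dC i m) (dC k i); move: (d m i) (d m k) (d i k); trop_lra.
suff [E2 [j2 [x [vj2 [xk xi]]]]] :
    exists E2 (j2 : {rmorphism vring E1 -> vring E2}) (x : vring E2),
      [/\ forall a, vval (j2 a) = vval a, vval (x - j2 (a k)) = d m k &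
          forall i, i \in s -> i != k ->
            vval (x - j2 (a i)) = tmin (d i k) (d m k)].
  exists E2, (j2 \o j1 : {rmorphism vring E -> vring E2}),
    (fun i => if i == m then x else j2 (a i)).
  split=> [b|]; first by rewrite /= vj2 vj1.
  have xE i : i \in s -> vval (x - j2 (a i)) = d m i.
    by move=> si; have [->|ik] := eqVneq i k; rewrite // xi // dm.
  move=> i l; rewrite !inE.
  have [->|im] := eqVneq i m; have [->|lm] := eqVneq l m; rewrite ?eqxx //=.
  - by move=> _ sl _; apply: xE.
  - by move=> si _ _; rewrite (valB_sym (@vvalP _ _ E2)) xE // dC.
  - by move=> si sl il; rewrite -rmorphB vj2 va.
(* At infinite [d m k] the new point is [a k] itself. *)
case Er : (d m k) => [r|]; last first.
  exists E1, (idfun : {rmorphism vring E1 -> vring E1}), (a k).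
  split=> //=; first by rewrite subrr (val0 (@vvalP _ _ E1)).
  by move=> i si ik; rewrite va // 1?eq_sym // dC; case: (d i k).
have [E2 [j2 [x [vj2 vx]]]] := exists_adjoin E1 r.
have v1 := val1 (@vvalP _ _ E1).
exists E2, j2, (j2 (a k) + x); split=> //.
  have := vx 0 1; rewrite rmorph0 rmorph1 mul1r add0r addrC addKr => ->.
  by rewrite v1 (val0 (@vvalP _ _ E1)) /= Rplus_0_l.
move=> i si ik; have := vx (a k - a i) 1; rewrite rmorphB rmorph1 mul1r addrAC => ->.
by rewrite va // 1?eq_sym // v1 dC /= Rplus_0_l.
Qed.

(** Subtracting [t i + t j], with [t i = W b i], turns the four-point condition through [b] into the
    ultrametric inequality for [d]. If the [a i] realize [d] and [u i] has value [t i], the columns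
    [u i * (1, a i)] have minors of value [W i j]. *)
Lemma realize_line (T : finType) (W : T -> T -> trop) E b c :
  (forall i j, W i j = W j i) -> (forall i, W i i = None) ->
  (forall i j k l, tle (tmin (tadd (W i k) (W j l)) (tadd (W i l) (W j k)))
                       (tadd (W i j) (W k l))) ->
  W b c <> None ->
  exists E' (x y : T -> vring E'), forall i j, vval (x i * y j - x j * y i) = W i j.
Proof.
move=> WC W0 W4 Wbc.
pose fin (x : trop) := if x is Some a then a else R0.
pose t i := W b i.
pose d i j := tadd (W i j) (Some (Ropp (Rplus (fin (t i)) (fin (t j))))).
pose s := [seq i <- enum T | t i].
have sP i : reflect (exists r, t i = Some r) (i \in s).
  rewrite mem_filter mem_enum andbT.
  by case: (t i) => [r|]; constructor; [exists r | case].
(* For [t i] finite and [t j] infinite, the four-point conditions on [b, c, i, j] give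
   [W i j = t i + W j c - W b c], which dictates the scalar at [j]. *)
pose sc i := if t i is Some _ then t i else tadd (W i c) (Some (Ropp (fin (W b c)))).
have [E1 [j1 [sg [_ vsg]]]] := realize_scalars sc (enum T) E.
have [||E2 [j2 [a [vj2 va]]]] := @realize_ultrametric T d s E1.
- by move=> i j; rewrite /d WC; congr tadd; congr Some; lra.
- move=> i j k /sP[p Ep] /sP[q Eq] /sP[r Er] _ _ _.
  have := W4 b k i j; rewrite -/(t i) -/(t j) -/(t k) /d Ep Eq Er /= (WC k i).
  by move: (W i j) (W i k) (W k j); trop_lra.
pose u i := j2 (sg i).
have vu i : vval (u i) = sc i by rewrite vj2 vsg // mem_enum.
have V2 := @vvalP _ _ E2.
(* the points with [t i = None] are those parallel to [b], at infinity *)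
exists E2, (fun i => if t i is Some _ then u i else 0),
           (fun i => if t i is Some _ then u i * a i else u i).
move=> i j; case Ei : (t i) => [p|]; case Ej : (t j) => [q|].
- have [<-|ij] := eqVneq i j; first by rewrite subrr (val0 V2) W0.
  have -> : u i * (u j * a j) - u j * (u i * a i) = u i * u j * (a j - a i) by ring.
  rewrite !(valM V2) va; [| by apply/sP; exists q | by apply/sP; exists p | by rewrite eq_sym].
  rewrite !vu /sc Ei Ej /d Ei Ej WC /fin.
  by move: (W i j); trop_lra.
- rewrite mul0r subr0 (valM V2) !vu /sc Ei Ej /fin.
  have := W4 b c i j; have := W4 b i c j; rewrite -/(t i) -/(t j) Ei Ej (WC c j) (WC c i).
  by move: Wbc; move: (W b c) (W i j) (W i c) (W j c); trop_lra.
- rewrite mul0r sub0r (valN V2) (valM V2) !vu /sc Ei Ej /fin.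
  have := W4 b c i j; have := W4 b j c i; rewrite -/(t i) -/(t j) Ei Ej (WC c j) (WC c i) (WC j i).
  by move: Wbc; move: (W b c) (W i j) (W i c) (W j c); trop_lra.
- rewrite !mul0r subrr (val0 V2).
  have := W4 b c i j; rewrite -/(t i) -/(t j) Ei Ej.
  by move: Wbc; move: (W b c) (W i j) (W c i) (W c j); trop_lra.
Qed.

End Realization.

Section IsotropicRealization.
Variables (A0 : comNzRingType) (v0 : A0 -> trop) (n : nat).

(* Rescaling the columns by elements of valuation 0 moves the minors without
   changing their valuations; a generic factor on the column [k2] keeps the
   compensating factor on the column [k1] from having a larger valuation. *)
Lemma realize_isotropic (E : valued_ext v0) (W : 'I_(n + n) -> 'I_(n + n) -> trop)
    (x y : 'I_(n + n) -> vring E) (k1 k2 : 'I_n) (al : R) :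
  (forall i j, vval (x i * y j - x j * y i) = W i j) -> k1 != k2 ->
  W (lshift n k1) (rshift n k1) = Some al ->
  W (lshift n k2) (rshift n k2) = Some al ->
  (forall k, tle (Some al) (W (lshift n k) (rshift n k))) ->
  exists (E' : valued_ext v0) (x' y' : 'I_(n + n) -> vring E'),
    (forall i j, vval (x' i * y' j - x' j * y' i) = W i j) /\
    sympl_minor x' y' = 0.
Proof.
move=> vW k12 W1 W2 Wmin.
pose P k := x (lshift n k) * y (rshift n k) - x (rshift n k) * y (lshift n k).
pose S := \sum_(k < n | (k != k1) && (k != k2)) P k.
have [E1 [j1 [t [vj1 vt]]]] := exists_adjoin E R0.
have [E2 [j2 [e [vj2 ve]]]] := exists_adjoin E1 (Ropp al).
have V := @vvalP _ _ E; have V1 := @vvalP _ _ E1; have V2 := @vvalP _ _ E2.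
pose N := - (j1 S + j1 (P k2) * t).
have vN : vval N = Some al.
  rewrite (valN V1) vt vW W2 /= Rplus_0_r.
  have : tle (Some al) (vval S) by apply: (val_sum_ge V) => k _; rewrite vW.
  by move: (vval S); trop_lra.
have vt0 : vval t = Some R0.
  have := vt 0 1; rewrite rmorph0 rmorph1 add0r mul1r => ->.
  by rewrite (val0 V) (val1 V) /= Rplus_0_l.
have ve0 : vval e = Some (Ropp al).
  have := ve 0 1; rewrite rmorph0 rmorph1 add0r mul1r => ->.
  by rewrite (val0 V1) (val1 V1) /= Rplus_0_l.
(* Multiplying all factors by [P k1] avoids dividing by it, and [e] brings their value back to [0].
   The form becomes a multiple of [N + P k2 * t + S], which is zero. *)
pose s i := e * j2 (if i == lshift n k1 then N else
  if i == lshift n k2 then j1 (P k1) * t else j1 (P k1)).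
have vs i : vval (s i) = Some R0.
  rewrite /s (valM V2) vj2 ve0; case: ifP => _.
    by rewrite vN /=; congr Some; lra.
  by case: ifP => _; rewrite ?(valM V1) ?vt0 vj1 vW W1 /=; congr Some; lra.
exists E2, (fun i => s i * j2 (j1 (x i))), (fun i => s i * j2 (j1 (y i))).
have Eminor i j : s i * j2 (j1 (x i)) * (s j * j2 (j1 (y j))) -
    s j * j2 (j1 (x j)) * (s i * j2 (j1 (y i))) =
    s i * s j * j2 (j1 (x i * y j - x j * y i)).
  by rewrite !rmorphB !rmorphM; ring.
split=> [i j|]; first by rewrite Eminor (valM V2 (s i * s j)) (valM V2 (s i) (s j)) !vs vj2 vj1 vW;
  case: (W i j) => //= r; congr Some; lra.
rewrite /sympl_minor; under eq_bigr do rewrite Eminor -/(P _).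
have sr k : s (rshift n k) = e * j2 (j1 (P k1)).
  by rewrite /s !(eq_sym (rshift n k)) !eq_lrshift.
rewrite (bigD1 k1) //= (bigD1 k2) 1?eq_sym //=.
rewrite (eq_bigr (fun k => (e * j2 (j1 (P k1))) ^+ 2 * j2 (j1 (P k)))); last first.
  move=> k /andP[kk1 kk2]; rewrite sr /s !(inj_eq (@lshift_inj _ _)) (negbTE kk1) (negbTE kk2).
  by rewrite expr2.
rewrite -mulr_sumr -!rmorph_sum -/S !sr /s eqxx.
rewrite !(inj_eq (@lshift_inj _ _)) (eq_sym k2) (negbTE k12) eqxx.
rewrite /N !rmorphN !rmorphD !rmorphM; ring.
Qed.

End IsotropicRealization.

(** * Minima attained twice and tropical monomials *)

Lemma min_twice3 x y z : min_twice [:: x; y; z] <->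
  [/\ tle (tmin y z) x, tle (tmin x z) y & tle (tmin x y) z].
Proof.
split.
  case=> [N|[a [b [ab b3 E le]]]].
    by have /= -> := N 0%N isT; have /= -> := N 1%N isT; have /= -> := N 2%N isT.
  have /= := le 0%N isT; have /= := le 1%N isT; have /= := le 2%N isT; move: E.
  by case: b ab b3 {le} => [|[|[|b]]] //; case: a => [|[|a]] // _ _ /=;
    move: x y z; clear; intros; split; trop_cases.
move=> [h1 h2 h3].
have claim : (x = y /\ tle x z) \/ (x = z /\ tle x y) \/ (y = z /\ tle y x).
  have [le12|le21] := tle_total x y; have [le13|le31] := tle_total x z;
    have [le23|le32] := tle_total y z;
    first [ solve [left; split; trop_cases]
          | solve [right; left; split; trop_cases]
          | solve [right; right; split; trop_cases] ].
right; case: claim => [[E le]|[[E le]|[E le]]].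
- exists 0%N, 1%N; split=> // -[|[|[|c]]] //= _; rewrite -?E //; exact: tle_refl.
- exists 0%N, 2%N; split=> // -[|[|[|c]]] //= _; rewrite -?E //; exact: tle_refl.
- exists 1%N, 2%N; split=> // -[|[|[|c]]] //= _; rewrite -?E //; exact: tle_refl.
Qed.

(** Distinct positions become distinct elements, so the order in which a support is listed no longer
    matters. *)
Lemma min_twice_map (T : eqType) (s : seq T) (F : T -> trop) : uniq s ->
  min_twice [seq F t | t <- s] <->
  ((forall t, t \in s -> F t = None) \/
   exists t t', [/\ t \in s, t' \in s, t != t', F t = F t' &
                    forall t'', t'' \in s -> tle (F t) (F t'')]).
Proof.
move=> Us; split.
  rewrite /min_twice size_map => -[N|[a [b [ab bs]]]].
    left=> t ts; have := N (index t s); rewrite index_mem => /(_ ts).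
    by rewrite (nth_map t) ?index_mem // nth_index.
  case: s Us bs => [//|t0 s] Us bs; have as_ := ltn_trans ab bs.
  rewrite !(nth_map t0) // => E le; right.
  exists (nth t0 (t0 :: s) a), (nth t0 (t0 :: s) b); split=> //; try exact: mem_nth.
    by rewrite nth_uniq // (ltn_eqF ab).
  move=> t ts; have := le (index t (t0 :: s)); rewrite index_mem => /(_ ts).
  by rewrite (nth_map t0) ?index_mem // nth_index.
rewrite /min_twice size_map => -[N|].
  left=> c cs; case: s Us N cs => [//|t0 s] Us N cs.
  by rewrite (nth_map t0) // N // mem_nth.
have key t t' : t \in s -> t' \in s -> (index t s < index t' s)%N -> F t = F t' ->
    (forall t'', t'' \in s -> tle (F t) (F t'')) ->
    exists a b, [/\ (a < b)%N, (b < size s)%N,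
      nth None [seq F t | t <- s] a = nth None [seq F t | t <- s] b &
      forall c, (c < size s)%N ->
        tle (nth None [seq F t | t <- s] a) (nth None [seq F t | t <- s] c)].
  move=> ts t's lt_tt' E le; exists (index t s), (index t' s).
  rewrite !(nth_map t) ?index_mem // !nth_index // ; split=> // c cs.
  by rewrite (nth_map t) //; apply: le; rewrite mem_nth.
case=> t [t' [ts t's tt' E le]]; right.
case: (ltngtP (index t s) (index t' s)) => [lt_i|lt_i|Ei].
- exact: key E le.
- by apply: key lt_i _ _ => //; rewrite -E.
- by rewrite -(nth_index t ts) Ei nth_index ?eqxx in tt'.
Qed.

Lemma eq_min_twice_map (T : eqType) (s s' : seq T) (F : T -> trop) :
  uniq s -> uniq s' -> s =i s' ->
  min_twice [seq F t | t <- s] <-> min_twice [seq F t | t <- s'].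
Proof.
move=> Us Us' Es; rewrite !min_twice_map //.
split=> -[N|[t [t' [ts t's tt' E le]]]].
- by left=> t; rewrite -Es; apply: N.
- by right; exists t, t'; rewrite -!Es; split=> // t''; rewrite -Es; apply: le.
- by left=> t; rewrite Es; apply: N.
- by right; exists t, t'; rewrite !Es; split=> // t''; rewrite Es; apply: le.
Qed.

Section TropicalTerms.
Variable N : nat.
Implicit Types (u : 'X_{1..N}) (w : 'I_N -> trop).

Lemma tscaleD a b x : tscale (a + b) x = tadd (tscale a x) (tscale b x).
Proof.
case: a b => [|a] [|b]; rewrite ?addn0 ?add0n.
- by rewrite /tscale /=; congr Some; lra.
- by rewrite taddC tadd0.
- by rewrite tadd0.
- case: x => // r; rewrite /tscale addSn /= -/(INR (a + b.+1).+1) -/(INR a.+1) -/(INR b.+1).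
  by congr Some; rewrite -addSn plus_INR; lra.
Qed.

Lemma tdotD u u' w : tdot (u + u')%MM w = tadd (tdot u w) (tdot u' w).
Proof.
rewrite /tdot; elim: (enum 'I_N) => [|i s IH] /=; first by congr Some; lra.
rewrite IH mnmDE tscaleD.
by move: (tscale (u i) _) (tscale (u' i) _) (foldr _ _ _) (foldr _ _ _); trop_lra.
Qed.

Lemma tdotU k w : tdot U_(k)%MM w = w k.
Proof.
rewrite /tdot.
have : k \in enum 'I_N by rewrite mem_enum.
have := enum_uniq 'I_N; elim: (enum 'I_N) => [//|i s IH] /= /andP[is_ Us].
rewrite inE mnm1E eq_sym; have [->|ki] := eqVneq k i => /= ks.
  have -> : foldr tadd (Some R0) [seq tscale (U_(i)%MM j) (w j) | j <- s] = Some R0.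
    elim: s is_ {IH Us ks} => [//|j s IH]; rewrite inE negb_or => /andP[ij js] /=.
    by rewrite IH // mnm1E (negbTE ij) /=; congr Some; lra.
  by rewrite tadd0 /tscale /=; case: (w i) => // a; congr Some; lra.
by rewrite IH //; case: (w k) => //= a; congr Some; lra.
Qed.

End TropicalTerms.

Lemma List_In_mem (T : eqType) (t : T) (s : seq T) : List.In t s <-> t \in s.
Proof.
elim: s => [//|a s IH] /=; rewrite inE; split.
  by case=> [->|/IH ->]; rewrite ?eqxx ?orbT.
by case/predU1P => [->|/IH]; [left | right].
Qed.

(** * The tropical relations *)

Section TropicalRelations.
Variables (K : fieldType) (v : K -> trop) (n : nat).
Hypothesis vP : is_valuation v.
Variable w : pairs n -> trop.
Local Notation w' := (fun i => w (enum_val i)).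
Local Notation co := (@Defs.coord n w).

Lemma in_trop_hyp_supp N (f : {mpoly K[N]}) z (s : seq 'X_{1..N}) :
  uniq s -> msupp f =i s ->
  in_trop_hyp v f z <-> min_twice [seq trop_term v f z u | u <- s].
Proof. by move=> Us Es; apply: eq_min_twice_map => //; apply: msupp_uniq. Qed.

(** The three monomials are distinct with coefficients [1] or [-1], of value zero in every
    characteristic. *)
Lemma trop_hyp_plucker (i j k l : 'I_(n + n)) :
  (i < j)%N -> (j < k)%N -> (k < l)%N ->
  in_trop_hyp v (plucker_rel K i j k l) w' <->
  min_twice [:: tadd (co i j) (co k l); tadd (co i k) (co j l); tadd (co i l) (co j k)].
Proof.
move=> ij jk kl.
have [a la ha] := pair_index ij.
have [b lb hb] := pair_index kl.
have [c lc hc] := pair_index (ltn_trans ij jk).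
have [d ld hd] := pair_index (ltn_trans jk kl).
have [e le he] := pair_index (ltn_trans (ltn_trans ij jk) kl).
have [f lf hf] := pair_index jk.
have Xpk o (p q : 'I_(n + n)) : lo o = p -> hi o = q -> Xp K p q = 'X_o.
  by move=> <- <-; rewrite Xp_lo_hi.
have cok o (p q : 'I_(n + n)) : lo o = p -> hi o = q -> co p q = w (enum_val o).
  by move=> <- <-; rewrite coord_lo_hi.
rewrite (cok a) // (cok b) // (cok c) // (cok d) // (cok e) // (cok f) //.
rewrite /plucker_rel (Xpk a) // (Xpk b) // (Xpk c) // (Xpk d) // (Xpk e) // (Xpk f) //.
rewrite -!mpolyXD.
have neq (o o' : 'I_(nvars n)) : (lo o != lo o') || (hi o != hi o') -> (o == o') = false.
  by move=> h; apply/negP => /eqP E; rewrite E !eqxx in h.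
have nat_neq (p q : 'I_(n + n)) : (p < q)%N -> (p != q) && (q != p).
  by move=> lt_pq; rewrite -!val_eqE /= (ltn_eqF lt_pq) (gtn_eqF lt_pq).
have /andP[Nij Nji] := nat_neq _ _ ij.
have /andP[Njk Nkj] := nat_neq _ _ jk.
have /andP[Nkl Nlk] := nat_neq _ _ kl.
have m12 : (U_(a) + U_(b) != U_(c) + U_(d) :> 'X_{1..nvars n})%MM.
  apply/eqP => /mnmP/(_ a); rewrite !mnmDE !mnm1E eqxx.
  rewrite (neq c a) ?(neq d a) ?lc ?la ?hc ?ha ?ld ?hd ?Nkj ?Nji ?orbT //.
have m13 : (U_(a) + U_(b) != U_(e) + U_(f) :> 'X_{1..nvars n})%MM.
  apply/eqP => /mnmP/(_ a); rewrite !mnmDE !mnm1E eqxx.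
  have /andP[_ Nlj] := nat_neq _ _ (ltn_trans jk kl).
  by rewrite (neq e a) ?(neq f a) ?le ?la ?he ?ha ?lf ?hf ?Nji ?Nlj ?orbT.
have m23 : (U_(c) + U_(d) != U_(e) + U_(f) :> 'X_{1..nvars n})%MM.
  apply/eqP => /mnmP/(_ c); rewrite !mnmDE !mnm1E eqxx.
  by rewrite (neq e c) ?(neq f c) ?le ?lc ?he ?hc ?lf ?hf ?Nji ?Nlk ?orbT.
set m1 := (U_(a) + U_(b))%MM; set m2 := (U_(c) + U_(d))%MM; set m3 := (U_(e) + U_(f))%MM.
rewrite -/m1 -/m2 -/m3 in m12 m13 m23.
pose F : {mpoly K[nvars n]} := 'X_[m1] - 'X_[m2] + 'X_[m3]; rewrite -/F.
have FE u : F@_u = (m1 == u)%:R - (m2 == u)%:R + (m3 == u)%:R.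
  by rewrite mcoeffD mcoeffB !mcoeffX.
have F1 : F@_m1 = 1 by rewrite FE eqxx !(eq_sym _ m1) (negbTE m12) (negbTE m13) subr0 addr0.
have F2 : F@_m2 = -1 by rewrite FE eqxx (negbTE m12) eq_sym (negbTE m23) sub0r addr0.
have F3 : F@_m3 = 1 by rewrite FE eqxx (negbTE m13) (negbTE m23) subr0 add0r.
rewrite (@in_trop_hyp_supp _ _ _ [:: m1; m2; m3]); last first.
- move=> u; rewrite mcoeff_msupp !inE.
  have [->|u1] := eqVneq u m1; first by rewrite F1 oner_eq0.
  have [->|u2] := eqVneq u m2; first by rewrite F2 oppr_eq0 oner_eq0.
  have [->|u3] := eqVneq u m3; first by rewrite F3 oner_eq0.
  by rewrite FE !(eq_sym _ u) (negbTE u1) (negbTE u2) (negbTE u3) subrr addr0 eqxx.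
- by rewrite /= !inE negb_or m12 m13 m23.
have rV : ring_valuation v by [].
rewrite /= /trop_term F1 F2 F3 (val1 rV) (valN1 rV) !(taddC (Some R0)) !tadd0.
by rewrite /m1 /m2 /m3 !tdotD !tdotU.
Qed.

Lemma trop_hyp_sympl : in_trop_hyp v (sympl_rel K n) w' <->
  min_twice [seq co (lshift n k) (rshift n k) | k <- enum 'I_n].
Proof.
have /fin_all_exists[o oP] (k : 'I_n) : exists o : 'I_(nvars n),
    lo o = lshift n k /\ hi o = rshift n k.
  have [|o lo_ ho] := @pair_index n (lshift n k) (rshift n k); last by exists o.
  by rewrite /=; have := ltn_ord k; lia.
have oI : injective o.
  by move=> k k' E; apply: (@lshift_inj n n); rewrite -(oP k).1 -(oP k').1 E.
pose g k : 'X_{1..nvars n} := U_(o k)%MM.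
have gI : injective g.
  move=> k k' /mnmP/(_ (o k)); rewrite !mnm1E eqxx.
  by case: eqP => // /oI ->.
have E : sympl_rel K n = \sum_(k < n) 'X_[g k].
  by apply: eq_bigr => k _; rewrite -(oP k).1 -(oP k).2 Xp_lo_hi.
have Eg k : (sympl_rel K n)@_(g k) = 1.
  rewrite E raddf_sum /= (bigD1 k) //= mcoeffX eqxx big1 ?addr0 // => k' kk'.
  by rewrite mcoeffX (inj_eq gI) (negbTE kk').
rewrite (@in_trop_hyp_supp _ _ _ [seq g k | k <- enum 'I_n]); last first.
- move=> u; rewrite mcoeff_msupp; apply/idP/mapP => [|[k _ ->]]; last by rewrite Eg oner_eq0.
  move=> nz; have [/existsP[k /eqP <-]|/existsPn none] := boolP [exists k, g k == u].
    by exists k; rewrite ?mem_enum.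
  move: nz; rewrite E raddf_sum /= big1 ?eqxx // => k _.
  by rewrite mcoeffX (negbTE (none k)).
- by rewrite map_inj_uniq ?enum_uniq.
rewrite -map_comp (@eq_map _ _ _ (fun k => co (lshift n k) (rshift n k))) // => k /=.
have rV : ring_valuation v by [].
by rewrite /trop_term Eg (val1 rV) taddC tadd0 tdotU -coord_lo_hi (oP k).1 (oP k).2.
Qed.

Lemma SpDr_relations :
  SpDr w <-> forall r, List.In r (relations K n) -> in_trop_hyp v r w'.
Proof.
split=> [[w4 ws] r|H].
  rewrite List_In_mem mem_rcons inE => /predU1P[->|/pluckersP]; first exact/trop_hyp_sympl.
  by case=> i [j [k [l [ij jk kl ->]]]]; apply/trop_hyp_plucker => //; apply: w4.
split=> [i j k l ij jk kl|].
  apply/trop_hyp_plucker => //; apply: H; rewrite List_In_mem mem_rcons inE.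
  by rewrite plucker_rel_in ?orbT.
by apply/trop_hyp_sympl; apply: H; rewrite List_In_mem mem_rcons mem_head.
Qed.

(** The diagonal gets the default infinity of [coord], as fits minors with a repeated column. *)
Definition sym_coord (i j : 'I_(n + n)) : trop :=
  if (i < j)%N then co i j else co j i.

Lemma sym_coordC i j : sym_coord i j = sym_coord j i.
Proof. by rewrite /sym_coord; case: ltngtP => // /val_inj ->. Qed.

Lemma sym_coordii i : sym_coord i i = None.
Proof. by rewrite /sym_coord /Defs.coord insubF ?ltnn. Qed.

Lemma sym_coord_lt (i j : 'I_(n + n)) : (i < j)%N -> sym_coord i j = co i j.
Proof. by rewrite /sym_coord => ->. Qed.

Definition four_point (i j k l : 'I_(n + n)) : Prop :=
  tle (tmin (tadd (sym_coord i k) (sym_coord j l)) (tadd (sym_coord i l) (sym_coord j k)))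
      (tadd (sym_coord i j) (sym_coord k l)).

Lemma four_point_swap i j k l : four_point i j k l -> four_point j i k l.
Proof.
rewrite /four_point (sym_coordC j i); move: (sym_coord i j) (sym_coord k l) (sym_coord i k)
  (sym_coord j l) (sym_coord i l) (sym_coord j k); trop_lra.
Qed.

Lemma four_point_swap_pairs i j k l : four_point i j k l -> four_point k l i j.
Proof.
rewrite /four_point (sym_coordC k i) (sym_coordC l j) (sym_coordC k j) (sym_coordC l i).
move: (sym_coord i j) (sym_coord k l) (sym_coord i k)
  (sym_coord j l) (sym_coord i l) (sym_coord j k); trop_lra.
Qed.

Lemma four_point_diag i k l : four_point i i k l.
Proof. by rewrite /four_point sym_coordii; case: (tmin _ _). Qed.

Lemma four_point_meet i j l : four_point i j i l.
Proof.
rewrite /four_point sym_coordii (sym_coordC j i).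
by move: (sym_coord i j) (sym_coord i l) (sym_coord j l); trop_lra.
Qed.

(** Symmetries reduce to [i < j], [k < l], [i < k]. Disjoint, crossing and nested pairs then match
    the three inequalities of [min_twice3], and coinciding indices are settled by the infinite
    diagonal. *)
Lemma SpDr_four_point i j k l : SpDr w -> four_point i j k l.
Proof.
move=> [w4 _].
have sorted (a b c d : 'I_(n + n)) : (a < b)%N -> (c < d)%N -> (a < c)%N -> four_point a b c d.
  move=> ab cd ac.
  case: (ltngtP b c) => [bc|cb|/val_inj <-]; last exact/four_point_swap/four_point_meet.
    rewrite /four_point !sym_coord_lt //; try lia.
    by have /min_twice3[] := w4 _ _ _ _ ab bc cd.
  case: (ltngtP b d) => [bd|db|/val_inj <-].
  - rewrite /four_point (sym_coordC b c) !sym_coord_lt //; try lia.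
    by have /min_twice3[] := w4 _ _ _ _ ac cb bd.
  - rewrite /four_point (sym_coordC b c) (sym_coordC b d) !sym_coord_lt //; try lia.
    by have /min_twice3[] := w4 _ _ _ _ ac cd db.
  - exact/four_point_swap/four_point_swap_pairs/four_point_swap/four_point_meet.
have half (a b c d : 'I_(n + n)) : (a < b)%N -> (c < d)%N -> four_point a b c d.
  move=> ab cd; case: (ltngtP a c) => [ac|ca|/val_inj <-]; first exact: sorted.
    exact/four_point_swap_pairs/sorted.
  exact: four_point_meet.
have third (a b c d : 'I_(n + n)) : (c < d)%N -> four_point a b c d.
  move=> cd; case: (ltngtP a b) => [ab|ba|/val_inj <-]; first exact: half.
    exact/four_point_swap/half.
  exact: four_point_diag.
case: (ltngtP k l) => [kl|lk|/val_inj <-]; first exact: third.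
  exact/four_point_swap_pairs/four_point_swap/four_point_swap_pairs/third.
exact/four_point_swap_pairs/four_point_diag.
Qed.

Lemma SpDr_realizable : not_all_inf w -> SpDr w ->
  exists (E : valued_ext v) (x y : 'I_(n + n) -> vring E),
    (forall k, vval (minors x y k) = w (enum_val k)) /\ sympl_minor x y = 0.
Proof.
move=> [J wJ] Sw.
have rV : ring_valuation v by [].
pose E0 : valued_ext v := ValuedExt (vemb := (idfun : {rmorphism K -> K})) rV (fun=> erefl).
have Wk k : sym_coord (lo k) (hi k) = w (enum_val k).
  by rewrite sym_coord_lt ?lo_lt_hi // coord_lo_hi.
have [|E [x [y vW]]] := @realize_line _ _ _ sym_coord E0 (lo (enum_rank J)) (hi (enum_rank J))
    sym_coordC sym_coordii (fun i j k l => SpDr_four_point i j k l Sw).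
  by rewrite Wk enum_rankK.
have W2 k : sym_coord (lshift n k) (rshift n k) = co (lshift n k) (rshift n k).
  by rewrite sym_coord_lt //=; have := ltn_ord k; lia.
have V := @vvalP _ _ E.
(* If all symplectic coordinates are infinite, the corresponding minors vanish and the lift is
   already isotropic. *)
have allN : (forall k, sym_coord (lshift n k) (rshift n k) = None) -> sympl_minor x y = 0.
  by move=> N; apply: big1 => k _; apply: (val_eq0 V); rewrite vW.
have := Sw.2; rewrite min_twice_map ?enum_uniq // => -[N|].
  exists E, x, y; split=> [k|]; first by rewrite vW Wk.
  by apply: allN => k; rewrite W2 N ?mem_enum.
case=> k1 [k2 [_ _ k12 E12 le]].
case Eal : (co (lshift n k1) (rshift n k1)) => [al|]; last first.
  exists E, x, y; split=> [k|]; first by rewrite vW Wk.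
  apply: allN => k; rewrite W2; have := le k; rewrite mem_enum Eal => /(_ isT).
  by case: (co _ _).
have [||k|E' [x' [y' [vW' s0]]]] := @realize_isotropic _ _ n E sym_coord x y k1 k2 al vW k12.
- by rewrite W2.
- by rewrite W2 -E12.
- by rewrite W2 -Eal; apply: le; rewrite mem_enum.
by exists E', x', y'; split=> // k; rewrite vW' Wk.
Qed.

(** At the lifted point each term of [f] has exactly its tropical value, and the terms sum to
    zero. *)
Lemma SpDr_vanishing f : not_all_inf w -> SpDr w -> in_ideal (relations K n) f ->
  in_trop_hyp v f w'.
Proof.
move=> wN Sw If; have [E [x [y [vw s0]]]] := SpDr_realizable wN Sw.
have V := @vvalP _ _ E.
apply/min_twice_map; first exact: msupp_uniq.
have vterm u : trop_term v f w' u = vval (vemb E f@_u * mmap1 (minors x y) u).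
  rewrite (valM V) vembE /trop_term; congr tadd.
  rewrite /mmap1 (val_prod V) /tdot -[index_enum _]enumT; congr foldr.
  by apply: eq_map => k; rewrite (valX V) vw.
have := val_sum0 V (msupp_uniq f) (mmap_relations (vemb E) If s0).
case=> [N|[u [u' [us u's uu' Eu le]]]]; [left | right].
  by move=> u us; rewrite vterm N.
by exists u, u'; rewrite !vterm; split=> // u'' u''s; rewrite vterm; apply: le.
Qed.

End TropicalRelations.

Theorem theorem4p8 (n p : nat) (K : closedFieldType) (val : K -> trop) :
  (2 <= n)%N -> has_char K p -> is_valuation val ->
  (* the relations generate S_{2,2n}(K) *)
  (forall f : {mpoly K[nvars n]}, S22n f <-> in_ideal (relations K n) f)
  (* they form a tropical basis *)
  /\ (forall w : pairs n -> trop, not_all_inf w ->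
        (forall r, List.In r (relations K n) ->
                   in_trop_hyp val r (fun i => w (enum_val i)))
        <-> TSpGr val w)
  (* equivalently SpDr(2,2n) = TSpGr_p(2,2n) *)
  /\ (forall w : pairs n -> trop, not_all_inf w -> SpDr w <-> TSpGr val w).
Proof.
move=> n2 _ vP.
have S_ideal f : S22n f <-> in_ideal (relations K n) f.
  by split; [apply: S22n_relations | apply: relations_S22n].
have main (w : pairs n -> trop) : not_all_inf w -> SpDr w <-> TSpGr val w.
  move=> wN; split=> [Sw f /(iffLR (S_ideal f)) If|Tw]; first exact: SpDr_vanishing.
  apply/(SpDr_relations vP) => r; rewrite List_In_mem => rr; apply: Tw.
  by apply/S_ideal; apply: in_ideal_mem.
split=> //; split=> // w wN.
by rewrite -(main w wN) (SpDr_relations vP w).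
Qed.
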